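(* Let $q\in[2,\infty)$ and let $(v,p)$ be a smooth axisymmetric solution with no swirl of the stationary Navier-Stokes equations $$(v\cdot\nabla)v+\nabla p=\Delta v,\qquad \nabla\cdot v=0,\qquad v(x_1,x_2,x_3+2\pi)=v(x_1,x_2,x_3)$$ in $\mathbb{R}^2\times S^1$. Assume that $$\int_{\mathbb{R}^2\times S^1}|\nabla v(x)|^q\,dx<\infty .$$ Then $v$ is a constant vector.
   Context: $S^1=[-\pi,\pi]$ is the $x_3$-variable range; the velocity $v=(v_1,v_2,v_3)$ is $2\pi$-periodic in $x_3$, and integrals over $\mathbb{R}^2\times S^1$ are over one period. $p$ is the scalar pressure. Cylindrical coordinates: $r=\sqrt{x_1^2+x_2^2}$, $\theta=\tan^{-1}(x_2/x_1)$, $z=x_3$, with $e_r=(x_1/r,x_2/r,0)$, $e_\theta=(-x_2/r,x_1/r,0)$, $e_z=(0,0,1)$, and $v=v^re_r+v^\theta e_\theta+v^ze_z$. The solution $(v,p)$ is axisymmetric if $v^r,v^\theta,v^z,p$ are independent of $\theta$; it has no swirl if $v^\theta\equiv 0$. $|\nabla v|$ denotes the Euclidean norm of the matrix of first partial derivatives of $v$ in Cartesian coordinates. *)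

(* Defs.v *)
From HB Require Import structures.
From mathcomp Require Import all_boot all_order all_algebra.
From mathcomp Require Import all_classical all_reals all_analysis.

Set Implicit Arguments.
Unset Strict Implicit.
Unset Printing Implicit Defensive.
Import Order.TTheory GRing.Theory Num.Theory.
Import numFieldNormedType.Exports.

Local Open Scope classical_set_scope.
Local Open Scope ring_scope.

Definition lebesgue2 {R : realType} :
    set (measurableTypeR R * measurableTypeR R) -> \bar R :=
  (@lebesgue_measure R \x @lebesgue_measure R)%E.

(* The library's sigma-finite structure on products of measures is not found
   by canonical inference for products of non-probability measures; it is
   needed for Fubini-type theorems on the product with a third factor. *)
Section Lebesgue2.
Context {R : realType}.
Local Open Scope ereal_scope.

HB.instance Definition _ := Measure.copy (@lebesgue2 R)
  (lebesgue_integral_fubini_product_measure1__canonical__measure_function_Measure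
     (@lebesgue_measure R) (@lebesgue_measure R)).

Let lebesgue2_sigma_finite : sigma_finite setT (@lebesgue2 R).
Proof.
have /sigma_finiteP[F [TF ndF Foo]] := sigma_finiteT (@lebesgue_measure R).
exists (fun n => F n `*` F n).
  rewrite -setXTT TF predeqE => -[x y]; split.
    move=> [/= [n _ Fnx] [k _ Gky]]; exists (maxn n k) => //; split.
    - by move: x Fnx; exact/subsetPset/ndF/leq_maxl.
    - by move: y Gky; exact/subsetPset/ndF/leq_maxr.
  by move=> [n _ []/= ? ?]; split; exists n.
move=> k; have [? ?] := Foo k.
split; first exact: measurableX.
by rewrite /lebesgue2 product_measure1E// lte_mul_pinfty// ge0_fin_numE.
Qed.

HB.instance Definition _ := Measure_isSigmaFinite.Build _ _ _ (@lebesgue2 R)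
  lebesgue2_sigma_finite.

End Lebesgue2.

Section Fields.
Context {R : realType}.
Implicit Types (f p : 'rV[R]_3 -> R) (v : 'rV[R]_3 -> 'rV[R]_3) (x : 'rV[R]_3).

(* Indices of type 'I_3 are elements of Z/3: the coordinates x_1, x_2, x_3 of x
   are x 0 0, x 0 1 and x 0 2. *)
Definition pt (a b c : R) : 'rV[R]_3 := \row_(i < 3) [:: a; b; c]`_i.

Definition dot (u w : 'rV[R]_3) : R := \sum_(i < 3) u 0 i * w 0 i.

Definition vcomp v (i : 'I_3) : 'rV[R]_3 -> R := fun x => v x 0 i.

Definition partial (i : 'I_3) f : 'rV[R]_3 -> R :=
  fun x => 'D_(delta_mx 0 i) f x.

Fixpoint class_C (k : nat) f : Prop :=
  if k is k'.+1 then
    (forall x, differentiable f x) /\ forall i, class_C k' (partial i f)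
  else continuous f.

Definition smooth f : Prop := forall k, class_C k f.

Definition smooth_field v : Prop := forall i, smooth (vcomp v i).

Definition laplacian f x : R := \sum_(j < 3) partial j (partial j f) x.

Definition divergence v x : R := \sum_(i < 3) partial i (vcomp v i) x.

Definition grad f x : 'rV[R]_3 := \row_(i < 3) partial i f x.

Definition convection v x : 'rV[R]_3 :=
  \row_(i < 3) \sum_(j < 3) v x 0 j * partial j (vcomp v i) x.

Definition vlaplacian v x : 'rV[R]_3 := \row_(i < 3) laplacian (vcomp v i) x.

Definition stationary_NS v p : Prop :=
  (forall x, convection v x + grad p x = vlaplacian v x) /\
  (forall x, divergence v x = 0).

Definition periodic_x3 v : Prop :=
  forall a b c : R, v (pt a b (c + 2 * pi)) = v (pt a b c).

Definition grad_norm v x : R :=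
  Num.sqrt (\sum_(i < 3) \sum_(j < 3) partial j (vcomp v i) x ^+ 2).

Definition radius x : R := Num.sqrt (x 0 0 ^+ 2 + x 0 1 ^+ 2).

(* On the axis radius x = 0, where e_r and e_theta are undefined, division by
   zero makes both of these the zero vector; they are used off the axis only. *)
Definition e_r x : 'rV[R]_3 := pt (x 0 0 / radius x) (x 0 1 / radius x) 0.
Definition e_theta x : 'rV[R]_3 :=
  pt (- x 0 1 / radius x) (x 0 0 / radius x) 0.
Definition e_z : 'rV[R]_3 := pt 0 0 1.

Definition v_r v x : R := dot (v x) (e_r x).
Definition v_theta v x : R := dot (v x) (e_theta x).
Definition v_z v x : R := dot (v x) e_z.

Definition cyl (r theta z : R) : 'rV[R]_3 :=
  pt (r * cos theta) (r * sin theta) z.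

Definition theta_independent f : Prop :=
  forall r theta theta' z : R, 0 < r ->
    f (cyl r theta z) = f (cyl r theta' z).

Definition axisymmetric v p : Prop :=
  [/\ theta_independent (v_r v), theta_independent (v_theta v),
      theta_independent (v_z v) & theta_independent p].

Definition no_swirl v : Prop := forall x, 0 < radius x -> v_theta v x = 0.

(* The slab R^2 x [-pi, pi], a fundamental domain of R^2 x S^1. *)
Definition slab : set (R * R * R) := [set y | - pi <= y.2 <= pi].

Definition grad_Lq_integral (q : R) v : \bar R :=
  \int[(@lebesgue2 R \x @lebesgue_measure R)%E]_(y in slab)
    (grad_norm v (pt y.1.1 y.1.2 y.2) `^ q)%:E.

End Fields.

(* Main.v *)
Require Import Defs.
From mathcomp Require Import all_boot all_order all_algebra.
From mathcomp Require Import all_classical all_reals all_analysis.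
From mathcomp Require Import measurable_realfun ring lra.
Import numFieldNormedType.Exports.
Import Order.TTheory GRing.Theory Num.Theory.

(** Without swirl and with axial symmetry the flow is determined by its trace
   on the half-plane x_2 = 0, x_1 = r > 0: the radial velocity u, the axial
   velocity w, and the vorticity om = u_z - w_r. Taking the curl of the momentum
   equations there ([plane_vorticity]) shows that Om = om / r satisfies a
   drift-diffusion equation without zeroth-order term, with divergence-free
   drift. For a convex function h this gives, with H = h(Om),

     r h''(Om) |grad Om|^2 = (d/dr) P + (d/dz) Q,   P = r H_r + 2 H - r u H.

   By periodicity in z the integral I(r) of P over a period is nondecreasing.
   It is nonnegative because P is bounded below by a multiple of - r near the
   axis, where om vanishes to first order. The choice h(s) = sqrt (1 + s^2) - 1, of linear
   growth, matters: r u H is then at most |u| |om|, which is quadratic in the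
   velocity gradient, whatever the exponent q.

   Incompressibility makes the mean of u over a period vanish, so that u is
   bounded by the slice integral of |u_z|, and the period integral of |u| |om|
   is at most 4 pi a(r), where a(r) is the period integral of u_z^2 + w_r^2. If
   I(r_0) = c > 0, then N(r), the period integral of r^2 H, has derivative

     N'(r) = r (I(r) + integral of r u H) >= r (c - 4 pi a(r))   for r >= r_0.

   The integrability of |grad v|^q enters only through the growth of
   A(r) = integral of s a(s) over [0, r]. As u_z^2 + w_r^2 is at most
   |grad v|^2 ([grad_norm_ge]) and t^2 <= d + C t^q, integrating over
   [0, r]^2 and a period yields A(r) <= d r^2 + C_d for every d > 0 ([energy_growth]).
   Hence N grows at least like c r^2 / 4. On the other hand N(r) is at most r
   times the integral of |om|, thus at most r (2 pi + 2 a(r)), so a(r) stays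
   above 1 for large r, against the growth of A. Therefore I = 0, and Om is
   constant on the half-plane in both variables; as om is then proportional to
   r, the smallness of A forces om = 0.

   An irrotational divergence-free flow is harmonic, and the period integral of
   u^2 is nondecreasing in r. It is bounded by a multiple of a(r), so it vanishes
   as well. Then u = 0 and w is constant ([meridional_liouville]). *)

(** * One-variable calculus *)

Section Calculus.
Local Open Scope classical_set_scope.
Local Open Scope ring_scope.
Context {R : realType}.
Implicit Types (f g : R -> R) (a b c d r s t x y z : R).

Lemma is_derive_add f g a b x : is_derive x 1 f a -> is_derive x 1 g b ->
  is_derive x 1 (fun y => f y + g y) (a + b).
Proof. exact: is_deriveD. Qed.

Lemma is_derive_opp f a x : is_derive x 1 f a ->
  is_derive x 1 (fun y => - f y) (- a).
Proof. exact: is_deriveN. Qed.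

Lemma is_derive_sub f g a b x : is_derive x 1 f a -> is_derive x 1 g b ->
  is_derive x 1 (fun y => f y - g y) (a - b).
Proof. exact: is_deriveB. Qed.

Lemma is_derive_mul f g a b x : is_derive x 1 f a -> is_derive x 1 g b ->
  is_derive x 1 (fun y => f y * g y) (a * g x + f x * b).
Proof.
move=> df dg; have := is_deriveM df dg.
by rewrite /GRing.scale /= addrC [g x * a]mulrC.
Qed.

Lemma is_derive_const (c x : R) : is_derive x 1 (fun=> c) 0.
Proof. exact: is_derive_cst. Qed.

Lemma is_derive_scale (c : R) f a x : is_derive x 1 f a ->
  is_derive x 1 (fun y => c * f y) (c * a).
Proof.
by move=> df; have := is_derive_mul _ _ _ _ _ (is_derive_const c x) df;
  rewrite mul0r add0r.
Qed.

Lemma is_derive_chain f g a b x : is_derive (g x) 1 f a ->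
  is_derive x 1 g b -> is_derive x 1 (fun y => f (g y)) (a * b).
Proof. exact: is_derive1_comp. Qed.

Lemma is_derive_inv x : x != 0 -> is_derive x 1 (fun y : R => y^-1) (- x ^- 2).
Proof.
move=> x0; have := @is_deriveV R id x 1 1 x0 (is_derive_id _ _).
by rewrite /GRing.scale /= mulr1.
Qed.

Lemma is_derive_continuous f a x : is_derive x 1 f a -> {for x, continuous f}.
Proof.
by move=> [df _]; apply/differentiable_continuous/derivable1_diffP.
Qed.

Lemma near_gt0 x : 0 < x -> \forall y \near x, 0 < y.
Proof. by move=> x0; exact: lt_nbhsr. Qed.

Lemma derive_ge0_le f f' a b : (forall x, a <= x <= b -> is_derive x 1 f (f' x)) ->
  (forall x, a <= x <= b -> 0 <= f' x) -> a <= b -> f a <= f b.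
Proof.
move=> df f0 ab; rewrite -subr_ge0.
have [x||c] := @MVT_segment R f f' a b ab.
- by rewrite in_itv/= => /andP[ax xb]; apply: df; rewrite !ltW.
- apply: derivable_within_continuous => y; rewrite in_itv/= => yab.
  by case: (df y yab).
by rewrite in_itv/= => cab ->; rewrite mulr_ge0 ?subr_ge0// f0.
Qed.

(** This replaces a boundary condition at the axis r = 0, where the quantities
   to which it is applied are not defined. *)
Lemma derive_ge0_ge0 f f' (K : R) :
  (forall x, 0 < x -> is_derive x 1 f (f' x)) ->
  (forall x, 0 < x -> 0 <= f' x) ->
  (forall x, 0 < x <= 1 -> - (K * x) <= f x) ->
  forall x, 0 < x -> 0 <= f x.
Proof.
move=> df f0 fK x x0.
have K1 : 0 < `|K| + 1 by rewrite ltr_wpDl.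
apply/ler_addgt0Pr => e e0.
pose y := Num.min (Num.min x 1) (e / (`|K| + 1)).
have y0 : 0 < y by rewrite !lt_min x0 ltr01 divr_gt0.
have yx : y <= x by rewrite !ge_min lexx.
have y1 : y <= 1 by rewrite !ge_min lexx orbT.
have ye : y <= e / (`|K| + 1) by rewrite !ge_min lexx orbT.
have fyx : f y <= f x.
  apply: (@derive_ge0_le f f') => // t /andP[yt _].
    exact/df/(lt_le_trans y0).
  exact/f0/(lt_le_trans y0).
have : - (K * y) <= f y by apply: fK; rewrite y0.
have : K * y <= e.
  rewrite (le_trans (y := (`|K| + 1) * y))//.
    by rewrite ler_pM2r// (le_trans (ler_norm K))// lerDl.
  by rewrite mulrC -ler_pdivlMr.
lra.
Qed.

Lemma is_derive_unique f g a b x : 0 < x -> (forall y, 0 < y -> f y = g y) ->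
  is_derive x 1 f a -> is_derive x 1 g b -> a = b.
Proof.
move=> x0 fg df [_ <-].
have : \near x, f x = g x by apply: filterS (near_gt0 x x0) => y; exact: fg.
by move=> /near_eq_is_derive/(_ df) [_ ->].
Qed.

Lemma derive0_const f : (forall x, 0 < x -> is_derive x 1 f 0) ->
  forall x y, 0 < x -> 0 < y -> f x = f y.
Proof.
move=> df x y x0 y0; wlog xy : x y x0 y0 / x <= y.
  by move=> H; case: (leP x y) => [|/ltW] yx; [|symmetry]; exact: H.
have dfx t : x <= t <= y -> is_derive t 1 f 0.
  by move=> /andP[xt _]; exact/df/(lt_le_trans x0).
have le1 : f x <= f y by apply: (derive_ge0_le f (fun=> 0)).
have le2 : - f x <= - f y.
  apply: (derive_ge0_le (fun t => - f t) (fun=> 0)) => // t txy.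
  by rewrite -[X in is_derive _ _ _ X]oppr0; apply: is_derive_opp; exact: dfx.
by apply/eqP; rewrite eq_le le1 -lerN2.
Qed.

Lemma eq_is_derive (f g : R -> R) x d d' : f = g -> is_derive x 1 f d ->
  is_derive x 1 g d' -> d = d'.
Proof. by move=> -> [_ <-] [_ <-]. Qed.

Lemma near_eq_derive_eq (f g : R -> R) x d d' : (\forall t \near x, f t = g t) ->
  is_derive x 1 f d -> is_derive x 1 g d' -> d = d'.
Proof. by move=> /near_eq_is_derive e /e [_ <-] [_ <-]. Qed.

Lemma vanishes_at_limit (f : R -> R) : {for 0, continuous f} ->
  (forall y, 0 < y -> f y = 0) -> f 0 = 0.
Proof.
move=> /cvgrPdist_lt cf f0; apply/eqP; rewrite -normr_le0.
apply/ler_addgt0Pr => e e0; rewrite add0r.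
have /nbhs_ballP [h /= h0 hh] := cf e e0.
have H : ball (0 : R) h (h / 2) -> `|f 0 - f (h / 2)| < e := @hh (h / 2).
have h20 : 0 < h / 2 by rewrite divr_gt0.
rewrite (f0 _ h20) subr0 in H; apply/ltW/H.
by rewrite /ball/= sub0r normrN ger0_norm ?divr_ge0 ?ltW//; lra.
Qed.

Lemma MVT_derive (F F' : R -> R) a b : a < b -> (forall t, is_derive t 1 F (F' t)) ->
  exists2 c, a <= c <= b & F b - F a = F' c * (b - a).
Proof.
move=> ab dF.
have cF : {within `[a, b], continuous F}.
  by apply: continuous_subspaceT => t; exact: is_derive_continuous.
have [c cab e] := @MVT R F F' a b ab (fun t _ => dF t) cF.
by exists c => //; move: cab; rewrite in_itv/= => /andP[c1 c2]; rewrite !ltW.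
Qed.

Lemma is_derive_hypot a y : 0 < a ^+ 2 + y ^+ 2 ->
  is_derive y 1 (fun y => Num.sqrt (a ^+ 2 + y ^+ 2)) (y / Num.sqrt (a ^+ 2 + y ^+ 2)).
Proof.
move=> p.
have d1 : is_derive y 1 (fun y : R => a ^+ 2 + y * y) (0 + (1 * y + y * 1)).
  by apply: is_derive_add; last exact: (is_derive_mul id id).
apply: is_derive_eq (is_derive_chain Num.sqrt (fun y : R => a ^+ 2 + y * y) _ _ y
  (is_derive1_sqrt p) d1) _.
have : 0 < Num.sqrt (a ^+ 2 + y ^+ 2) by rewrite sqrtr_gt0.
rewrite expr2; set q := Num.sqrt _ => q0 /=.
by field; rewrite gt_eqF.
Qed.

Lemma polar_angle a b : a ^+ 2 + b ^+ 2 = 1 -> exists t, cos t = a /\ sin t = b.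
Proof.
move=> ab.
have a1 : -1 <= a <= 1 by have b20 := sqr_ge0 b; apply/andP; split; nra.
have S : Num.sqrt (1 - a ^+ 2) = `|b|.
  by rewrite -sqrtr_sqr; congr Num.sqrt; lra.
have [b0|/ltW b0] := leP 0 b.
  by exists (acos a); rewrite acosK ?in_itv// sin_acos// S ger0_norm.
exists (- acos a); rewrite cosN sinN acosK ?in_itv// sin_acos// S ler0_norm//.
by rewrite opprK.
Qed.

Lemma solve_div r a b c : r != 0 -> a + r * b + r * c = 0 -> c = - (a + r * b) / r.
Proof. by move=> rn e; apply: (mulfI rn); rewrite mulrCA mulfV// mulr1; lra. Qed.

Lemma sum_ge_parts (a b c d e f : R) : 0 <= a -> 0 <= b -> 0 <= c -> 0 <= d ->
  0 <= e -> 0 <= f -> let K := a + b + (c + d) + (e + f) in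
  [/\ 0 <= K, a <= K, b <= K, c + d <= K & e + f <= K].
Proof. by move=> ? ? ? ? ? ? K; rewrite /K; split; lra. Qed.

End Calculus.

(** * Functions on the half-plane r > 0 and integrals over a period *)

Section HalfPlane.
Local Open Scope classical_set_scope.
Local Open Scope ring_scope.
Context {R : realType}.
Implicit Types (f g : R -> R -> R).

Definition cont2_at f (r z : R) := {for (r, z), continuous (fun x : R * R => f x.1 x.2)}.

Definition cont2 f := forall r z : R, 0 < r -> cont2_at f r z.

(** The partial derivatives are explicit arguments, so that calculations with
   them are algebra, free of proofs of differentiability. The axis r = 0 is
   left out because of the divisions by r in cylindrical coordinates. *)
Definition C1 f f1 f2 := [/\ cont2 f, cont2 f1, cont2 f2,
  forall r z : R, 0 < r -> is_derive r 1 (f ^~ z) (f1 r z) &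
  forall r z : R, 0 < r -> is_derive z 1 (f r) (f2 r z)].

Lemma cont2_eq f g : (forall r z : R, 0 < r -> f r z = g r z) -> cont2 f -> cont2 g.
Proof.
move=> fg cf r z r0; have := cf r z r0.
rewrite /cont2_at /prop_for /continuous_at /= -fg// => cfr.
apply: cvg_trans cfr; apply: near_eq_cvg.
have : \forall x \near (r, z), 0 < x.1.
  exists ([set y | 0 < y], setT) => /=.
    by split; [exact: near_gt0|exact: filterT].
  by move=> [y t] [].
by apply: filterS => x x0; rewrite fg.
Qed.

Lemma cont2_cst c : cont2 (fun _ _ => c).
Proof. by move=> r z _; exact: cvg_cst. Qed.

Lemma cont2_r : cont2 (fun r _ => r).
Proof. by move=> r z _; exact: cvg_fst. Qed.

Lemma cont2_add f g : cont2 f -> cont2 g -> cont2 (fun r z => f r z + g r z).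
Proof. by move=> cf cg r z r0; apply: cvgD; [exact: cf|exact: cg]. Qed.

Lemma cont2_opp f : cont2 f -> cont2 (fun r z => - f r z).
Proof. by move=> cf r z r0; apply: cvgN; exact: cf. Qed.

Lemma cont2_mul f g : cont2 f -> cont2 g -> cont2 (fun r z => f r z * g r z).
Proof. by move=> cf cg r z r0; apply: cvgM; [exact: cf|exact: cg]. Qed.

Lemma cont2_comp (phi : R -> R) f : continuous phi -> cont2 f ->
  cont2 (fun r z => phi (f r z)).
Proof.
move=> cphi cf r z r0.
by apply: (@continuous_comp _ _ _ (fun x : R * R => f x.1 x.2) phi);
  [exact: cf|exact: cphi].
Qed.

Lemma cont2_inv : cont2 (fun r _ => r^-1).
Proof.
move=> r z r0; apply: (@cvgV _ _ _ _ (fun x : R * R => x.1)) => //=.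
  by rewrite gt_eqF.
exact: cvg_fst.
Qed.

Lemma cont2_norm f : cont2 f -> cont2 (fun r z => `|f r z|).
Proof. by apply: cont2_comp; exact: norm_continuous. Qed.

Lemma cont2_slice f r : 0 < r -> cont2 f -> continuous (f r).
Proof.
move=> r0 cf z.
apply: (@continuous2_cvg _ _ _ _ (nbhs z) _ (fun=> r) id f).
- exact: cf.
- exact: cvg_cst.
- exact: cvg_id.
Qed.

Lemma C1_eq f f1 f2 g1 g2 : C1 f f1 f2 ->
  (forall r z : R, 0 < r -> f1 r z = g1 r z) ->
  (forall r z : R, 0 < r -> f2 r z = g2 r z) -> C1 f g1 g2.
Proof.
move=> [cf cf1 cf2 df1 df2] e1 e2; split => //.
- exact: cont2_eq cf1.
- exact: cont2_eq cf2.
- by move=> r z r0; rewrite -e1//; exact: df1.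
- by move=> r z r0; rewrite -e2//; exact: df2.
Qed.

Lemma C1_cst c : C1 (fun _ _ => c) (fun _ _ => 0) (fun _ _ => 0).
Proof.
split; try exact: cont2_cst; move=> r z _; exact: is_derive_const.
Qed.

Lemma C1_r : C1 (fun r _ => r) (fun _ _ => 1) (fun _ _ => 0).
Proof.
split; try exact: cont2_cst; first exact: cont2_r.
- by move=> r z _; exact: is_derive_id.
- by move=> r z _; exact: is_derive_const.
Qed.

Lemma C1_inv : C1 (fun r _ => r^-1) (fun r _ => - r ^- 2) (fun _ _ => 0).
Proof.
split; [exact: cont2_inv| |exact: cont2_cst| |].
- apply: (@cont2_eq (fun r _ => - (r^-1 * r^-1))).
    by move=> r z r0; rewrite expr2 invfM.
  by apply: cont2_opp; apply: cont2_mul; exact: cont2_inv.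
- by move=> r z r0; apply: is_derive_inv; rewrite gt_eqF.
- by move=> r z _; exact: is_derive_const.
Qed.

Lemma C1_add f f1 f2 g g1 g2 : C1 f f1 f2 -> C1 g g1 g2 ->
  C1 (fun r z => f r z + g r z) (fun r z => f1 r z + g1 r z)
     (fun r z => f2 r z + g2 r z).
Proof.
move=> [cf cf1 cf2 df1 df2] [cg cg1 cg2 dg1 dg2].
split; try exact: cont2_add.
- by move=> r z r0; apply: is_derive_add; [exact: df1|exact: dg1].
- by move=> r z r0; apply: is_derive_add; [exact: df2|exact: dg2].
Qed.

Lemma C1_opp f f1 f2 : C1 f f1 f2 ->
  C1 (fun r z => - f r z) (fun r z => - f1 r z) (fun r z => - f2 r z).
Proof.
move=> [cf cf1 cf2 df1 df2].
split; try exact: cont2_opp.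
- by move=> r z r0; apply: is_derive_opp; exact: df1.
- by move=> r z r0; apply: is_derive_opp; exact: df2.
Qed.

Lemma C1_mul f f1 f2 g g1 g2 : C1 f f1 f2 -> C1 g g1 g2 ->
  C1 (fun r z => f r z * g r z)
     (fun r z => f1 r z * g r z + f r z * g1 r z)
     (fun r z => f2 r z * g r z + f r z * g2 r z).
Proof.
move=> [cf cf1 cf2 df1 df2] [cg cg1 cg2 dg1 dg2].
split; try (apply: cont2_add; apply: cont2_mul => //); first exact: cont2_mul.
- by move=> r z r0; apply: (is_derive_mul (f ^~ z) (g ^~ z));
    [exact: df1|exact: dg1].
- by move=> r z r0; apply: is_derive_mul; [exact: df2|exact: dg2].
Qed.

Lemma C1_comp (phi phi' : R -> R) f f1 f2 :
  (forall x : R, is_derive x 1 phi (phi' x)) -> continuous phi' -> C1 f f1 f2 ->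
  C1 (fun r z => phi (f r z)) (fun r z => phi' (f r z) * f1 r z)
     (fun r z => phi' (f r z) * f2 r z).
Proof.
move=> dphi cphi' [cf cf1 cf2 df1 df2].
have cphi : continuous phi by move=> x; apply: is_derive_continuous.
split; first exact: cont2_comp.
- by apply: cont2_mul => //; exact: cont2_comp.
- by apply: cont2_mul => //; exact: cont2_comp.
- move=> r z r0; apply: (is_derive_chain phi (f ^~ z)) => //; exact: df1.
- move=> r z r0; apply: (is_derive_chain phi (f r)) => //; exact: df2.
Qed.

Lemma C1_div_r f f1 f2 : C1 f f1 f2 ->
  C1 (fun r z => f r z / r) (fun r z => f1 r z / r - f r z / r ^+ 2)
     (fun r z => f2 r z / r).
Proof.
move=> Cf; apply: C1_eq (C1_mul _ _ _ _ _ _ Cf C1_inv) _ _ => r z r0.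
- by rewrite mulrN.
- by rewrite mulr0 addr0.
Qed.

Lemma bounded_on_rectangle f a b c d :
  (forall r z, a <= r <= b -> c <= z <= d -> cont2_at f r z) ->
  exists2 K, 0 <= K & forall r z, a <= r <= b -> c <= z <= d -> `|f r z| <= K.
Proof.
move=> cf.
pose A : set (R * R) := `[a, b]%classic `*` `[c, d]%classic.
have cA : compact A by apply: compact_setX; exact: segment_compact.
have : compact ((fun x : R * R => f x.1 x.2) @` A).
  apply: continuous_compact cA.
  apply: continuous_in_subspaceT => -[r z]; rewrite inE /A /= !in_itv/=.
  by move=> [rab zcd]; exact: cf.
move=> /compact_bounded [M [_ hM]].
exists (`|M| + 1) => [|r z rab zcd]; first by rewrite addr_ge0.
apply: (hM (`|M| + 1)); first by rewrite (le_lt_trans (ler_norm _))// ltrDl.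
by exists (r, z) => //; rewrite /A /= !in_itv/=.
Qed.

End HalfPlane.

Section PeriodIntegral.
Local Open Scope classical_set_scope.
Local Open Scope ring_scope.
Context {R : realType}.
Implicit Types (f g : R -> R).

Definition zint f : R := \int[@lebesgue_measure R]_(z in `[- pi, pi]) f z.

Lemma pi_itv : (- pi : R) < pi.
Proof. by have := pi_gt0 R; lra. Qed.

Lemma continuous_integrable f (a b : R) : continuous f ->
  (@lebesgue_measure R).-integrable `[a, b] (EFin \o f).
Proof.
move=> cf; apply: continuous_compact_integrable.
  exact: segment_compact.
exact: continuous_subspaceT.
Qed.

Lemma eq_zint f g : (forall z : R, - pi <= z <= pi -> f z = g z) -> zint f = zint g.
Proof. by move=> fg; apply: eq_Rintegral => z; rewrite inE/= in_itv/=; exact: fg. Qed.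

Lemma zint_ge0 f : (forall z : R, - pi <= z <= pi -> 0 <= f z) -> 0 <= zint f.
Proof. by move=> f0; apply: Rintegral_ge0 => z/=; rewrite in_itv/=; exact: f0. Qed.

Lemma zint_add f g : continuous f -> continuous g ->
  zint (fun z => f z + g z) = zint f + zint g.
Proof. by move=> cf cg; apply: RintegralD => //; exact: continuous_integrable. Qed.

Lemma zint_sub f g : continuous f -> continuous g ->
  zint (fun z => f z - g z) = zint f - zint g.
Proof. by move=> cf cg; apply: RintegralB => //; exact: continuous_integrable. Qed.

Lemma zint_scale c f : continuous f -> zint (fun z => c * f z) = c * zint f.
Proof. by move=> cf; apply: RintegralZl => //; exact: continuous_integrable. Qed.

Lemma zint_le f g : continuous f -> continuous g ->
  (forall z : R, - pi <= z <= pi -> f z <= g z) -> zint f <= zint g.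
Proof.
move=> cf cg fg; apply: le_Rintegral => //; exact: continuous_integrable.
Qed.

Lemma zint_norm f : continuous f -> `|zint f| <= zint (fun z => `|f z|).
Proof. by move=> cf; apply: le_normr_Rintegral => //; exact: continuous_integrable. Qed.

Lemma FTC_segment f F (a b : R) : a < b -> {within `[a, b], continuous f} ->
  (forall z, a <= z <= b -> is_derive z 1 F (f z)) ->
  \int[@lebesgue_measure R]_(z in `[a, b]) f z = F b - F a.
Proof.
move=> ab cf dF.
have cF z : a <= z <= b -> {for z, continuous F}.
  by move=> zab; exact: is_derive_continuous (dF z zab).
have itvW z : z \in `]a, b[ -> a <= z <= b.
  by rewrite in_itv/= => /andP[az zb]; rewrite !ltW.
rewrite /Rintegral (@continuous_FTC2 _ f F)//=.
- split => [z /itvW zab| |].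
  + by case: (dF z zab).
  + by apply: cvg_at_right_filter; apply: cF; rewrite lexx ltW.
  + by apply: cvg_at_left_filter; apply: cF; rewrite lexx ltW.
- by move=> z /itvW zab; rewrite derive1E; case: (dF z zab).
Qed.

Lemma integral_segment_cst c (a b : R) : a < b ->
  \int[@lebesgue_measure R]_(z in `[a, b]) c = c * (b - a).
Proof.
move=> ab.
have dF (z : R) : is_derive z 1 (fun z => c * z) c.
  by have := is_derive_scale c _ _ _ (is_derive_id z 1); rewrite mulr1.
have cc : continuous ((fun=> c) : R -> R) by move=> z; exact: cvg_cst.
by rewrite (FTC_segment (fun=> c) (fun z => c * z) a b ab
  (continuous_subspaceT cc) (fun z _ => dF z)) mulrBr.
Qed.

Lemma zint_cst c : zint (fun=> c) = c * (2 * pi).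
Proof. by rewrite /zint integral_segment_cst ?pi_itv//; ring. Qed.

Lemma zint_eq0 f : continuous f -> (forall z : R, - pi <= z <= pi -> 0 <= f z) ->
  zint f = 0 -> forall z : R, - pi <= z <= pi -> f z = 0.
Proof.
move=> cf f0 f_zint0 z zpi; apply/eqP; rewrite eq_le f0// andbT leNgt; apply/negP => fz0.
have : \forall y \near z, f z / 2 < f y.
  by move: (cf z) => /cvgr_gt; apply; lra.
move=> /nbhs_ballP [e /= e0 he].
pose c := Num.max (- pi) (z - e / 2).
pose d := Num.min pi (z + e / 2).
have cd : c < d.
  have := pi_gt0 R; move: zpi => /andP[z1 z2] p0.
  by rewrite lt_min !gt_max; apply/and3P; split; try apply/andP; try split; lra.
have sub : `[c, d] `<=` `[- pi, pi : R].
  by apply: subset_itv; rewrite bnd_simp ?le_max ?ge_min lexx.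
have : (f z / 2) * (d - c) <= zint f.
  have -> : (f z / 2) * (d - c) = \int[@lebesgue_measure R]_(y in `[c, d]) (f z / 2).
    by rewrite integral_segment_cst.
  apply: (@le_trans _ _ (\int[@lebesgue_measure R]_(y in `[c, d]) f y)).
    apply: le_Rintegral => //; try exact: continuous_integrable.
      by apply: continuous_integrable => y; exact: cvg_cst.
    move=> y/=; rewrite in_itv/= => /andP[cy yd]; apply/ltW/he => /=.
    move: cy yd; rewrite ge_max le_min => /andP[_ zy] /andP[_ yz].
    by rewrite /ball/= ltr_norml; apply/andP; split; lra.
  rewrite /zint /Rintegral fine_le//.
  - by apply: integrable_fin_num => //; exact: continuous_integrable.
  - by apply: integrable_fin_num => //; exact: continuous_integrable.
  - apply: ge0_subset_integral => //.
      by case/integrableP : (continuous_integrable f (- pi) pi cf).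
rewrite f_zint0; have : 0 < (f z / 2) * (d - c) by rewrite mulr_gt0 ?divr_gt0 ?subr_gt0.
lra.
Qed.

Lemma zint_CauchySchwarz f : continuous f -> zint f ^+ 2 <= 2 * pi * zint (fun z => f z ^+ 2).
Proof.
move=> cf.
have p0 := pi_gt0 R.
(* Integrating the square of f minus its mean m gives the inequality. *)
set m := zint f / (2 * pi).
have cm : continuous ((fun=> m) : R -> R) by move=> z; exact: cvg_cst.
have csq : continuous (fun z => f z ^+ 2).
  by move=> z; apply: cvgM; exact: cf.
have cmf : continuous (fun z => 2 * m * f z).
  by move=> z; apply: cvgM; [exact: cvg_cst|exact: cf].
have : 0 <= zint (fun z => (f z - m) ^+ 2) by apply: zint_ge0 => z _; exact: sqr_ge0.
have -> : zint (fun z => (f z - m) ^+ 2) = zint (fun z => f z ^+ 2) - zint f ^+ 2 / (2 * pi).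
  transitivity (zint (fun z => (f z ^+ 2 - 2 * m * f z) + m ^+ 2)).
    by apply: eq_zint => z _; ring.
  rewrite zint_add; last 2 first.
  - by move=> z; apply: cvgB; [exact: csq|exact: cmf].
  - by move=> z; exact: cvg_cst.
  rewrite zint_sub// zint_scale// zint_cst /m.
  by move: (zint f) (zint _) (pi : R) p0 => a b c c0; field; rewrite gt_eqF.
by rewrite subr_ge0 ler_pdivrMr ?mulr_gt0// mulrC.
Qed.

Lemma zint_FTC (f f1 f2 : R -> R -> R) (r : R) : C1 f f1 f2 -> 0 < r ->
  zint (f2 r) = f r pi - f r (- pi).
Proof.
move=> [_ _ cf2 _ df2] r0; apply: FTC_segment; first exact: pi_itv.
  by apply: continuous_subspaceT; exact: cont2_slice.
by move=> z _; exact: df2.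
Qed.

Lemma is_derive_zint (f f1 f2 : R -> R -> R) (r : R) : C1 f f1 f2 -> 0 < r ->
  is_derive r 1 (fun s => zint (f s)) (zint (f1 r)).
Proof.
move=> [cf cf1 _ df _] r0.
have [K K0 hK] : exists2 K, 0 <= K & forall s z : R, r / 2 <= s <= 2 * r ->
    - pi <= z <= pi -> `|f1 s z| <= K.
  by apply: bounded_on_rectangle => s z /andP[s1 s2] _; apply: cf1; lra.
have Ir : `]r / 2, 2 * r[%classic r by rewrite /= in_itv/=; apply/andP; split; lra.
have intf : forall x, `]r / 2, 2 * r[%classic x ->
    (@lebesgue_measure R).-integrable `[- pi, pi] (EFin \o f x).
  move=> x; rewrite /= in_itv/= => /andP[x1 x2].
  by apply: continuous_integrable; apply: cont2_slice => //; lra.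
have der : forall x y, `]r / 2, 2 * r[%classic x -> `[- pi, pi]%classic y ->
    derivable (f ^~ y) x 1.
  move=> x y; rewrite /= in_itv/= => /andP[x1 x2] _.
  have x0 : 0 < x by lra.
  by case: (df x y x0).
have intK : (@lebesgue_measure R).-integrable `[- pi, pi] (EFin \o (fun=> K)).
  by apply: continuous_integrable => z; exact: cvg_cst.
have ub : forall x y, `]r / 2, 2 * r[%classic x -> `[- pi, pi]%classic y ->
    `|partial1of2 f x y| <= K.
  move=> x y; rewrite /= !in_itv/= => /andP[x1 x2] ypi.
  have [_] : is_derive x 1 (f ^~ y) (f1 x y) by apply: df; lra.
  by rewrite partial1of2E => ->; apply: hK => //; apply/andP; split; lra.
have K0' : forall y : R, 0 <= (fun=> K) y by [].
have mI : measurable (`[- pi, pi]%classic : set (measurableTypeR R)) by [].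
apply: DeriveDef.
  exact: (@derivable_under_integral R _ (measurableTypeR R) lebesgue_measure f _
    mI r _ _ Ir intf der _ K0' intK ub).
rewrite -derive1E.
rewrite (@differentiation_under_integral R _ (measurableTypeR R) lebesgue_measure
  f _ mI r _ _ Ir intf der _ K0' intK ub).
apply: eq_zint => z _; rewrite partial1of2E.
by have [_] := df r z r0.
Qed.

Lemma osc_le_zint f (F : R -> R) (y z : R) : continuous f ->
  (forall t : R, is_derive t 1 F (f t)) ->
  - pi <= y <= pi -> - pi <= z <= pi -> `|F z - F y| <= zint (fun t => `|f t|).
Proof.
move=> cf dF; wlog yz : y z / y <= z.
  move=> H ypi zpi; case: (leP y z) => [|/ltW] yz; first exact: H.
  by rewrite distrC; exact: H.
move=> /andP[y1 y2] /andP[z1 z2].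
have cn : continuous (fun t => `|f t|).
  by move=> t; apply: cvg_norm; exact: cf.
move: yz; rewrite le_eqVlt => /predU1P[->|yz].
  by rewrite subrr normr0; apply: zint_ge0.
rewrite -(FTC_segment f F y z yz (continuous_subspaceT cf) (fun t _ => dF t)).
have sub : `[y, z] `<=` `[- pi, pi : R].
  by apply: subset_itv; rewrite bnd_simp.
apply: (le_trans (le_normr_Rintegral _ _)) => //.
  exact: continuous_integrable.
rewrite /zint /Rintegral fine_le//.
- by apply: integrable_fin_num => //; exact: continuous_integrable.
- by apply: integrable_fin_num => //; exact: continuous_integrable.
- apply: ge0_subset_integral => //.
  by case/integrableP : (continuous_integrable (fun t => `|f t|) (- pi) pi cn).
Qed.

End PeriodIntegral.

(** * A convex function of linear growth *)

Section ConvexProfile.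
Local Open Scope classical_set_scope.
Local Open Scope ring_scope.
Context {R : realType}.
Implicit Types s : R.

(** Convexity gives the dissipation a sign, and linear growth keeps the transport
   term at most quadratic in the velocity gradient. The rounding of the
   absolute value at the origin makes the function twice differentiable, with
   positive second derivative everywhere, so that the dissipation controls the
   whole gradient. *)
Definition profile s := Num.sqrt (1 + s ^+ 2) - 1.
Definition profile' s := s / Num.sqrt (1 + s ^+ 2).
Definition profile'' s := (Num.sqrt (1 + s ^+ 2))^-1 ^+ 3.

Let q_gt0 s : 0 < 1 + s ^+ 2.
Proof. by rewrite ltr_pwDl// sqr_ge0. Qed.

Let sq_gt0 s : 0 < Num.sqrt (1 + s ^+ 2).
Proof. by rewrite sqrtr_gt0. Qed.

Let sqE s : Num.sqrt (1 + s ^+ 2) ^+ 2 = 1 + s ^+ 2.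
Proof. by rewrite sqr_sqrtr// ltW. Qed.

Let is_derive_sq s :
  is_derive s 1 (fun t => Num.sqrt (1 + t ^+ 2)) (profile' s).
Proof.
have d1 : is_derive s 1 (fun t : R => 1 + t * t) (0 + (1 * s + s * 1)).
  apply: is_derive_add; last exact: (is_derive_mul id id).
have d2 := is_derive_chain Num.sqrt (fun t : R => 1 + t * t) _ _ s
   (is_derive1_sqrt (q_gt0 s)) d1.
apply: is_derive_eq d2 _.
have := sq_gt0 s; rewrite /profile' expr2; set t := Num.sqrt _ => t0 /=.
field; by rewrite gt_eqF.
Qed.

Lemma is_derive_profile s : is_derive s 1 profile (profile' s).
Proof.
have := is_derive_sub _ _ _ _ _ (is_derive_sq s) (is_derive_const 1 s).
by rewrite subr0.
Qed.

Lemma is_derive_profile' s : is_derive s 1 profile' (profile'' s).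
Proof.
have n0 : Num.sqrt (1 + s ^+ 2) != 0 by rewrite gt_eqF.
have d := is_derive_mul id _ _ _ _ (is_derive_id s 1)
  (is_derive_chain (fun t : R => t^-1) (fun t => Num.sqrt (1 + t ^+ 2)) _ _ _
    (is_derive_inv _ n0) (is_derive_sq s)).
apply: is_derive_eq d _.
rewrite /profile' /profile''.
have E : s ^+ 2 = Num.sqrt (1 + s ^+ 2) ^+ 2 - 1 by rewrite sqE; ring.
move: n0 E; set t := Num.sqrt _; move=> n0 E.
have -> : 1 * t^-1 + s * (- t ^- 2 * (s / t)) = t^-1 - s ^+ 2 * t ^- 3 by field.
by rewrite E; field.
Qed.

Lemma continuous_profile' : continuous profile'.
Proof. by move=> s; apply: is_derive_continuous (is_derive_profile' s). Qed.

Lemma continuous_profile'' : continuous profile''.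
Proof.
move=> s; have n0 : Num.sqrt (1 + s ^+ 2) != 0 by rewrite gt_eqF.
have c : {for s, continuous (fun t : R => (Num.sqrt (1 + t ^+ 2))^-1)}.
  apply: cvgV => //; exact: is_derive_continuous (is_derive_sq s).
by apply: (cvgM c (cvgM c c)).
Qed.

Lemma profile_ge0 s : 0 <= profile s.
Proof.
have : Num.sqrt (1 : R) <= Num.sqrt (1 + s ^+ 2).
  by rewrite ler_sqrt ?lerDl ?sqr_ge0// ltW.
by rewrite sqrtr1 /profile subr_ge0.
Qed.

Lemma profile_le s : profile s <= `|s|.
Proof.
have : Num.sqrt (1 + s ^+ 2) <= Num.sqrt ((1 + `|s|) ^+ 2).
  rewrite ler_sqrt ?sqr_ge0// sqrrD real_normK ?num_real// expr1n mul1r lerD2r.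
  by rewrite lerDl mulrn_wge0.
by rewrite sqrtr_sqr ger0_norm ?addr_ge0// /profile lerBlDl.
Qed.

Lemma profile'_le1 s : `|profile' s| <= 1.
Proof.
rewrite /profile' normrM normfV (gtr0_norm (sq_gt0 s)) ler_pdivrMr// mul1r.
have : Num.sqrt (s ^+ 2) <= Num.sqrt (1 + s ^+ 2).
  by rewrite ler_sqrt ?lerDr ?ltW.
by rewrite sqrtr_sqr.
Qed.

Lemma profile''_gt0 s : 0 < profile'' s.
Proof. by rewrite exprn_gt0// invr_gt0. Qed.

End ConvexProfile.

(** * The Liouville theorem in the meridional half-plane *)

Section MeridionalFlow.
Local Open Scope classical_set_scope.
Local Open Scope ring_scope.
Context {R : realType}.
Implicit Types (r s t x y z m d : R).

(** If a stayed above m, its primitive A with weight r would grow like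
   m r^2 / 2, but A is o(r^2). Every contradiction below is of this kind. *)
Lemma slice_energy_not_bounded_below (a A : R -> R) :
  (forall r, 0 < r -> is_derive r 1 A (r * a r)) ->
  (forall d, 0 < d -> exists C, forall r, 0 < r -> A r <= d * r ^+ 2 + C) ->
  forall m r0, 0 < m -> 0 < r0 -> (forall r, r0 <= r -> m <= a r) -> False.
Proof.
move=> dA hA m r0 m0 r00 ha.
have [C hC] := hA (m / 4) (divr_gt0 m0 (ltr0n _ 4)).
pose c := C + m * r0 ^+ 2 / 2 - A r0.
have grow r : r0 <= r -> A r0 - m * r0 ^+ 2 / 2 <= A r - m * r ^+ 2 / 2.
  move=> r0r.
  apply: (derive_ge0_le (fun t => A t - m * t ^+ 2 / 2) (fun t => t * a t - m * t)) => //.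
    move=> x /andP[x1 _]; have x0 : 0 < x by exact: lt_le_trans x1.
    apply: is_derive_sub; first exact: dA.
    have := is_derive_scale (m / 2) _ _ _
      (is_derive_mul id id _ _ _ (is_derive_id x 1) (is_derive_id x 1)).
    rewrite (_ : (fun y => m / 2 * (id y * id y)) = (fun t => m * t ^+ 2 / 2)); last first.
      by apply/funext => t /=; rewrite expr2; ring.
    by move=> d; apply: is_derive_eq d _ => /=; field.
  move=> x /andP[x1 _]; rewrite subr_ge0 mulrC ler_pM2l ?ha//.
  exact: lt_le_trans x1.
(* Since r >= 1, m r^2 / 4 is at least m r / 4, which exceeds c. *)
pose r := r0 + 1 + `|c| * 4 / m.
have cm0 : 0 <= `|c| * 4 / m by rewrite !mulr_ge0// invr_ge0 ltW.
have r1 : 1 <= r by rewrite /r; lra.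
have rr0 : r0 <= r by rewrite /r; lra.
have h1 := grow r rr0.
have h2 : A r <= m / 4 * r ^+ 2 + C by apply: hC; lra.
have h3 : m * r <= m * r ^+ 2.
  by rewrite expr2 ler_pM2l// ler_peMr//; lra.
have h4 : m * r = m * r0 + m + `|c| * 4 by rewrite /r; field; rewrite gt_eqF.
have h5 : c <= `|c| := ler_norm c.
have h6 : 0 < m * r0 by rewrite mulr_gt0.
rewrite /c in h5 h4.
have : m * r ^+ 2 / 4 <= c by rewrite /c; lra.
rewrite /c; lra.
Qed.

Context (u u1 u2 u11 u12 w w1 w2 w11 w12 w22 : R -> R -> R).
Context (om om1 om2 om11 om12 om21 om22 : R -> R -> R) (A : R -> R).
Hypotheses (Cu : C1 u u1 u2) (Cu1 : C1 u1 u11 u12).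
Hypotheses (Cw : C1 w w1 w2) (Cw1 : C1 w1 w11 w12) (Cw2 : C1 w2 w12 w22).
Hypotheses (Com : C1 om om1 om2) (Com1 : C1 om1 om11 om12)
  (Com2 : C1 om2 om21 om22).
Hypothesis omE : forall r z : R, 0 < r -> om r z = u2 r z - w1 r z.
Hypothesis div_free : forall r z : R, 0 < r -> u r z + r * u1 r z + r * w2 r z = 0.
Hypothesis vorticity_eq : forall r z : R, 0 < r ->
  u r z * om1 r z + w r z * om2 r z - u r z / r * om r z =
  om11 r z + om22 r z + om1 r z / r - om r z / r ^+ 2.
Hypotheses (per_u : forall r z : R, 0 < r -> u r (z + 2 * pi) = u r z)
  (per_w : forall r z : R, 0 < r -> w r (z + 2 * pi) = w r z)
  (per_w1 : forall r z : R, 0 < r -> w1 r (z + 2 * pi) = w1 r z)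
  (per_om : forall r z : R, 0 < r -> om r (z + 2 * pi) = om r z)
  (per_om2 : forall r z : R, 0 < r -> om2 r (z + 2 * pi) = om2 r z).
Context (K : R).
Hypothesis axis : forall r z : R, 0 < r <= 1 -> - pi <= z <= pi ->
  [/\ `|u r z| <= K, `|u1 r z| <= K, `|om r z| <= K * r &
      `|om1 r z - om r z / r| <= K * r].
Let a r := zint (fun z => u2 r z ^+ 2 + w1 r z ^+ 2).
Hypothesis dA : forall r : R, 0 < r -> is_derive r 1 A (r * a r).
Hypothesis A_small : forall d : R, 0 < d ->
  exists C : R, forall r : R, 0 < r -> A r <= d * r ^+ 2 + C.

Let energy_not_bounded_below :
  forall m r0, 0 < m -> 0 < r0 -> (forall r, r0 <= r -> m <= a r) -> False.
Proof. exact: slice_energy_not_bounded_below dA A_small. Qed.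

Let pi0 : 0 < (pi : R). Proof. exact: pi_gt0. Qed.

Let per_pi (f : R -> R -> R) : (forall r z : R, 0 < r -> f r (z + 2 * pi) = f r z) ->
  forall r, 0 < r -> f r pi = f r (- pi).
Proof. by move=> pf r r0; rewrite -(pf r (- pi) r0); congr (f r _); ring. Qed.

Let cu := let: And5 c _ _ _ _ := Cu in c.
Let cu1 := let: And5 c _ _ _ _ := Cu1 in c.
Let cu2 := let: And5 _ _ c _ _ := Cu in c.
Let cw1 := let: And5 c _ _ _ _ := Cw1 in c.
Let cw2 := let: And5 c _ _ _ _ := Cw2 in c.
Let com := let: And5 c _ _ _ _ := Com in c.

Let cont_sq (f : R -> R -> R) : cont2 f -> cont2 (fun r z => f r z ^+ 2).
Proof. by move=> cf; apply: (cont2_mul f f). Qed.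

Let ca : cont2 (fun r z => u2 r z ^+ 2 + w1 r z ^+ 2).
Proof. by apply: cont2_add; exact: cont_sq. Qed.

Let cG : cont2 (fun r z => `|u2 r z| + `|w1 r z|).
Proof. by apply: cont2_add; exact: cont2_norm. Qed.

Let zint_G_sq r : 0 < r -> zint (fun z => `|u2 r z| + `|w1 r z|) ^+ 2 <= 4 * pi * a r.
Proof.
move=> r0; apply: le_trans (zint_CauchySchwarz _ (cont2_slice _ _ r0 cG)) _.
rewrite [leRHS](_ : _ = 2 * pi * (2 * a r)); last by ring.
rewrite ler_pM2l ?mulr_gt0// /a -zint_scale; last exact: (cont2_slice _ _ r0 ca).
apply: zint_le.
- exact: (cont2_slice _ _ r0 (cont_sq _ cG)).
- by move=> z; apply: cvgM; [exact: cvg_cst|exact: (cont2_slice _ _ r0 ca)].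
move=> z _; rewrite -(real_normK (num_real (u2 r z))) -(real_normK (num_real (w1 r z))).
by have := sqr_ge0 (`|u2 r z| - `|w1 r z|); nra.
Qed.

(** The equation div_free is d(r u)/dr + d(r w)/dz = 0: the flux of u through
   a cylinder over one period does not depend on its radius, and it vanishes at
   the axis. *)
Lemma zint_u_eq0 r : 0 < r -> zint (u r) = 0.
Proof.
pose f s := zint (fun z => s * u s z).
have df s : 0 < s -> is_derive s 1 f 0.
  move=> s0; have d := is_derive_zint _ _ _ s (C1_mul _ _ _ _ _ _ C1_r Cu) s0.
  apply: is_derive_eq d _.
  rewrite (@eq_zint _ _ (fun z => - s * w2 s z)); last first.
    by move=> z _; have := div_free s z s0; lra.
  rewrite zint_scale; last exact: cont2_slice.
  rewrite (zint_FTC _ _ _ _ Cw s0).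
  by rewrite (per_pi _ per_w)// subrr mulr0.
have fK s : 0 < s <= 1 -> `|f s| <= K * (2 * pi) * s.
  move=> s01; have s0 : 0 < s by case/andP: s01.
  have csu : cont2 (fun r z => r * u r z) by apply: cont2_mul => //; exact: cont2_r.
  apply: le_trans (zint_norm _ (cont2_slice _ _ s0 csu)) _.
  rewrite [leRHS](_ : _ = zint (fun=> K * s)); last by rewrite zint_cst; ring.
  apply: zint_le; [exact: (cont2_slice _ _ s0 (cont2_norm _ csu))|by move=> z; exact: cvg_cst|].
  move=> z zpi; rewrite normrM gtr0_norm// mulrC ler_pM2r//.
  by case: (axis s z s01 zpi).
move=> r0.
have f1 : 0 <= f r.
  apply: (derive_ge0_ge0 f (fun=> 0) (K * (2 * pi))) => // s s01.
  by rewrite lerNl (le_trans _ (fK s s01))// -normrN ler_norm.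
have f2 : 0 <= - f r.
  apply: (derive_ge0_ge0 (fun t => - f t) (fun=> 0) (K * (2 * pi))) => // s s01.
    by rewrite -[X in is_derive _ _ _ X]oppr0; apply: is_derive_opp; exact: df.
  by rewrite lerN2 (le_trans _ (fK s s01))// ler_norm.
have : f r = 0 by lra.
rewrite /f zint_scale; last exact: cont2_slice.
by move/eqP; rewrite mulf_eq0 gt_eqF//= => /eqP.
Qed.

(** As u has mean zero over a period, it is bounded by its oscillation. *)
Let u_le r z : 0 < r -> - pi <= z <= pi ->
  `|u r z| <= zint (fun z => `|u2 r z| + `|w1 r z|).
Proof.
move=> r0 zpi.
have cur : continuous (u r) by exact: cont2_slice.
have X0 : `|u r z| <= zint (fun z => `|u2 r z|).
  have E : u r z * (2 * pi) = zint (fun y => u r z - u r y).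
    by rewrite zint_sub ?zint_cst ?zint_u_eq0 ?subr0//; move=> y; exact: cvg_cst.
  have cd : continuous (fun y => u r z - u r y).
    by move=> y; apply: cvgB; [exact: cvg_cst|exact: cur].
  rewrite -(@ler_pM2r _ (2 * pi)) ?mulr_gt0//.
  rewrite -{1}(@gtr0_norm _ (2 * pi)) ?mulr_gt0// -normrM E.
  apply: le_trans (zint_norm _ cd) _.
  rewrite -zint_cst; apply: zint_le.
  - by move=> y; apply: cvg_norm; exact: cd.
  - by move=> y; exact: cvg_cst.
  move=> y ypi; apply: osc_le_zint => //; first exact: cont2_slice.
  by move=> x; case: Cu => _ _ _ _; exact.
apply: le_trans X0 _; apply: zint_le.
- exact: (cont2_slice _ _ r0 (cont2_norm _ cu2)).
- exact: (cont2_slice _ _ r0 cG).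
- by move=> y _; rewrite lerDl.
Qed.

Let zint_usq_le r : 0 < r -> zint (fun z => u r z ^+ 2) <= 8 * pi ^+ 2 * a r.
Proof.
move=> r0; set X := zint (fun z => `|u2 r z| + `|w1 r z|).
apply: (@le_trans _ _ (zint (fun=> X ^+ 2))).
  apply: zint_le; [exact: (cont2_slice _ _ r0 (cont_sq _ cu))|by move=> y; exact: cvg_cst|].
  move=> z zpi; rewrite -(real_normK (num_real (u r z))) ler_sqr ?nnegrE//.
    exact: u_le.
  by apply: zint_ge0 => y _; rewrite addr_ge0.
rewrite zint_cst [leRHS](_ : _ = (4 * pi * a r) * (2 * pi)); last by ring.
by rewrite ler_pM2r ?mulr_gt0//; exact: zint_G_sq.
Qed.

Let om_le r z : 0 < r -> `|om r z| <= `|u2 r z| + `|w1 r z|.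
Proof. by move=> r0; rewrite omE// (le_trans (ler_normB _ _)). Qed.

Let zint_uom_le r : 0 < r -> zint (fun z => `|u r z| * `|om r z|) <= 4 * pi * a r.
Proof.
move=> r0; set X := zint (fun z => `|u2 r z| + `|w1 r z|).
apply: le_trans (zint_G_sq r r0); rewrite -/X expr2.
rewrite -{2}/X [in leRHS]/X -zint_scale; last exact: (cont2_slice _ _ r0 cG).
apply: zint_le.
- by apply: (cont2_slice (fun r z => `|u r z| * `|om r z|)) => //;
    apply: cont2_mul; exact: cont2_norm.
- by move=> z; apply: cvgM; [exact: cvg_cst|exact: (cont2_slice _ _ r0 cG)].
- by move=> z zpi; apply: ler_pM => //; [exact: u_le|exact: om_le].
Qed.

Let zint_om_le r : 0 < r -> zint (fun z => `|om r z|) <= 2 * pi + 2 * a r.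
Proof.
move=> r0.
rewrite -[2 * pi]mul1r -zint_cst /a -zint_scale; last exact: (cont2_slice _ _ r0 ca).
have c2a : continuous (fun z => 2 * (u2 r z ^+ 2 + w1 r z ^+ 2)).
  by move=> z; apply: cvgM; [exact: cvg_cst|exact: (cont2_slice _ _ r0 ca)].
rewrite -zint_add//; last by move=> z; exact: cvg_cst.
apply: zint_le.
- exact: (cont2_slice _ _ r0 (cont2_norm _ com)).
- by move=> z; apply: cvgD; [exact: cvg_cst|exact: c2a].
move=> z _; apply: le_trans (om_le r z r0) _.
rewrite -(real_normK (num_real (u2 r z))) -(real_normK (num_real (w1 r z))).
have := sqr_ge0 (`|u2 r z| - 1); have := sqr_ge0 (`|w1 r z| - 1).
have := sqr_ge0 `|u2 r z|; have := sqr_ge0 `|w1 r z|.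
rewrite !expr2; lra.
Qed.

Let a_ge_om r : 0 < r -> zint (fun z => om r z ^+ 2) <= 2 * a r.
Proof.
move=> r0; rewrite /a -zint_scale; last exact: (cont2_slice _ _ r0 ca).
apply: zint_le.
- exact: (cont2_slice _ _ r0 (cont_sq _ com)).
- by move=> z; apply: cvgM; [exact: cvg_cst|exact: (cont2_slice _ _ r0 ca)].
by move=> z _; rewrite omE//; have := sqr_ge0 (u2 r z + w1 r z); nra.
Qed.

(** The stretching term of the vorticity equation is exactly what division by r
   removes: the resulting equation is the one called transport in the proof of
   the entropy identity. *)
Let Om r z := om r z / r.
Let Om1 r z := om1 r z / r - om r z / r ^+ 2.
Let Om2 r z := om2 r z / r.
Let Om11 r z := om11 r z / r - 2 * om1 r z / r ^+ 2 + 2 * om r z / r ^+ 3.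
Let Om12 r z := om12 r z / r - om2 r z / r ^+ 2.
Let Om21 r z := om21 r z / r - om2 r z / r ^+ 2.
Let Om22 r z := om22 r z / r.

Let COm : C1 Om Om1 Om2. Proof. exact: C1_div_r. Qed.

Let COm1 : C1 Om1 Om11 Om12.
Proof.
have C := C1_add _ _ _ _ _ _ (C1_div_r _ _ _ Com1)
  (C1_opp _ _ _ (C1_div_r _ _ _ (C1_div_r _ _ _ Com))).
have E : (fun r z => om1 r z / r + - (om r z / r / r)) = Om1.
  by apply/funext => r; apply/funext => z; rewrite /Om1 expr2 invfM mulrA.
rewrite E in C.
by apply: C1_eq C _ _ => r z r0; rewrite /Om11 /Om12; field; rewrite gt_eqF.
Qed.

Let COm2 : C1 Om2 Om21 Om22. Proof. exact: C1_div_r. Qed.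

Let H r z := profile (Om r z).
Let H1 r z := profile' (Om r z) * Om1 r z.
Let H2 r z := profile' (Om r z) * Om2 r z.

Let CH : C1 H H1 H2.
Proof. by apply: C1_comp => //; [exact: is_derive_profile|exact: continuous_profile']. Qed.

Let rH_le r z : 0 < r -> r * H r z <= `|om r z|.
Proof.
move=> r0; apply: (@le_trans _ _ (r * `|Om r z|)).
  by rewrite ler_pM2l//; exact: profile_le.
by rewrite /Om normrM normfV (gtr0_norm r0) mulrCA mulfV ?mulr1// gt_eqF.
Qed.

Let ruH_le r z : 0 < r -> `|r * (u r z * H r z)| <= `|u r z| * `|om r z|.
Proof.
move=> r0; rewrite mulrCA normrM ler_wpM2l// ger0_norm; first exact: rH_le.
by apply: mulr_ge0; [exact: ltW|exact: profile_ge0].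
Qed.

Let Cp' : C1 (fun r z => profile' (Om r z))
  (fun r z => profile'' (Om r z) * Om1 r z) (fun r z => profile'' (Om r z) * Om2 r z).
Proof. by apply: C1_comp => //; [exact: is_derive_profile'|exact: continuous_profile'']. Qed.

Let CH1 := C1_mul _ _ _ _ _ _ Cp' COm1.
Let CH2 := C1_mul _ _ _ _ _ _ Cp' COm2.
Let Cr2 : C1 (fun _ _ => 2 : R) (fun _ _ => 0) (fun _ _ => 0) := C1_cst 2.

Let P r z := r * H1 r z + 2 * H r z - r * (u r z * H r z).
Let Q r z := r * H2 r z - r * (w r z * H r z).

Let H11 r z := profile'' (Om r z) * Om1 r z * Om1 r z + profile' (Om r z) * Om11 r z.
Let H22 r z := profile'' (Om r z) * Om2 r z * Om2 r z + profile' (Om r z) * Om22 r z.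
Let P1 r z := 3 * H1 r z + r * H11 r z
   - (u r z * H r z + r * u1 r z * H r z + r * u r z * H1 r z).
Let Q2 r z := r * H22 r z - (r * w2 r z * H r z + r * w r z * H2 r z).

Let CP : C1 P P1 (fun r z => r * (profile'' (Om r z) * Om2 r z * Om1 r z
    + profile' (Om r z) * Om12 r z) + 2 * H2 r z
    - r * (u2 r z * H r z + u r z * H2 r z)).
Proof.
have C := C1_add _ _ _ _ _ _ (C1_add _ _ _ _ _ _ (C1_mul _ _ _ _ _ _ C1_r CH1)
  (C1_mul _ _ _ _ _ _ Cr2 CH)) (C1_opp _ _ _ (C1_mul _ _ _ _ _ _ C1_r
    (C1_mul _ _ _ _ _ _ Cu CH))).
apply: C1_eq C _ _ => r z r0 /=.
  by rewrite /P1 /H11 /H1; ring.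
by rewrite /H2; ring.
Qed.

Let CQ : C1 Q (fun r z => H2 r z + r * (profile'' (Om r z) * Om1 r z * Om2 r z
    + profile' (Om r z) * Om21 r z)
    - (w r z * H r z + r * (w1 r z * H r z + w r z * H1 r z))) Q2.
Proof.
have C := C1_add _ _ _ _ _ _ (C1_mul _ _ _ _ _ _ C1_r CH2)
  (C1_opp _ _ _ (C1_mul _ _ _ _ _ _ C1_r (C1_mul _ _ _ _ _ _ Cw CH))).
apply: C1_eq C _ _ => r z r0 /=.
  by rewrite /H2 /H1; ring.
by rewrite /Q2 /H22 /H2; ring.
Qed.

Let D r z := r * profile'' (Om r z) * (Om1 r z ^+ 2 + Om2 r z ^+ 2).

(** Multiply the equation for Om by h'(Om): the diffusion leaves the
   dissipation D, and the transport is a divergence since the drift is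
   divergence-free. *)
Let entropy r z : 0 < r -> P1 r z = D r z - Q2 r z.
Proof.
move=> r0.
have transport : 3 * Om1 r z + r * Om11 r z + r * Om22 r z
    - r * (u r z * Om1 r z + w r z * Om2 r z) = 0.
  transitivity (om11 r z + om22 r z + om1 r z / r - om r z / r ^+ 2 -
     (u r z * om1 r z + w r z * om2 r z - u r z / r * om r z)).
    by rewrite /Om1 /Om2 /Om11 /Om22; field; rewrite gt_eqF.
  by rewrite vorticity_eq// subrr.
rewrite /P1 /Q2 /H11 /H22 /D /H1 /H2.
set b := profile'' _; set c := profile' _; set h := H r z.
rewrite [LHS](_ : _ = r * b * (Om1 r z ^+ 2 + Om2 r z ^+ 2)
  - (r * (b * Om2 r z * Om2 r z + c * Om22 r z)
      - (r * w2 r z * h + r * w r z * (c * Om2 r z)))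
  + c * (3 * Om1 r z + r * Om11 r z + r * Om22 r z
    - r * (u r z * Om1 r z + w r z * Om2 r z))
  - (u r z + r * u1 r z + r * w2 r z) * h); last by ring.
by rewrite transport div_free// mulr0 mul0r addr0 subr0.
Qed.

Let I r := zint (P r).

Let cD : cont2 D.
Proof.
have [cOm cOm1 cOm2 _ _] := COm.
have cp : cont2 (fun r z => profile'' (Om r z)).
  by apply: cont2_comp => //; exact: continuous_profile''.
by apply: cont2_mul; [apply: cont2_mul => //; exact: cont2_r|
  apply: cont2_add; exact: cont_sq].
Qed.

Let dI r : 0 < r -> is_derive r 1 I (zint (D r)).
Proof.
move=> r0; have d := is_derive_zint _ _ _ r CP r0; apply: is_derive_eq d _.
have cQ2 : cont2 Q2 by case: CQ.
rewrite (@eq_zint _ _ (fun z => D r z - Q2 r z)); last by move=> z _; exact: entropy.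
rewrite zint_sub; [|exact: cont2_slice|exact: cont2_slice].
rewrite (zint_FTC _ _ _ _ CQ r0).
have -> : Q r pi = Q r (- pi).
  by rewrite /Q /H2 /H /Om2 /Om !(per_pi _ per_om)// !(per_pi _ per_om2)// !(per_pi _ per_w).
by rewrite subrr subr0.
Qed.

Let D_ge0 r z : 0 < r -> 0 <= D r z.
Proof.
by move=> r0; rewrite mulr_ge0 ?addr_ge0 ?sqr_ge0// mulr_ge0 ?ltW// profile''_gt0.
Qed.

(** Near the axis om = O(r) and d(om)/dr - om / r = O(r), so all terms of P are
   O(r) except 2 H, which is nonnegative. *)
Let I_ge0 r : 0 < r -> 0 <= I r.
Proof.
apply: (derive_ge0_ge0 I (fun r => zint (D r)) ((K + K * K) * (2 * pi))) => // s.
  by move=> s0; apply: zint_ge0 => z _; exact: D_ge0.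
move=> s01; have /andP[s0 s1] := s01.
rewrite [leLHS](_ : _ = zint (fun=> - ((K + K * K) * s))); last by rewrite zint_cst; ring.
apply: zint_le.
- by move=> z; exact: cvg_cst.
- by apply: cont2_slice => //; case: CP.
move=> z zpi; have [uK u1K omK om1K] := axis s z s01 zpi.
have K0 : 0 <= K := le_trans (normr_ge0 _) uK.
have h1 : `|s * H1 s z| <= K * s.
  rewrite /H1 (_ : s * _ = profile' (Om s z) * (om1 s z - om s z / s)); last first.
    by rewrite /Om1; field; rewrite gt_eqF.
  rewrite normrM -[leRHS]mul1r; apply: ler_pM => //; exact: profile'_le1.
have h2 : `|s * (u s z * H s z)| <= K * K * s.
  by apply: le_trans (ruH_le s z s0) _; rewrite -mulrA; exact: ler_pM.
have h3 : 0 <= H s z := profile_ge0 _.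
move: h1 h2; rewrite !ler_norml /P => /andP[h1 _] /andP[_ h2]; lra.
Qed.

Let I_le r s : 0 < r -> r <= s -> I r <= I s.
Proof.
move=> r0 rs; apply: (derive_ge0_le I (fun r => zint (D r))) => // x /andP[rx _].
  by apply: dI; exact: lt_le_trans rx.
by apply: zint_ge0 => z _; apply: D_ge0; exact: lt_le_trans rx.
Qed.

(** If I(r0) = c > 0, the integral N of r^2 H grows at least like c r^2 / 4: the
   error r u H costs only a multiple of the energy A = o(r^2). Since H is bounded
   by |om| / r, the slice energy a would then be bounded below. *)
Let I_eq0 r0 : 0 < r0 -> I r0 = 0.
Proof.
move=> r00; apply/eqP; rewrite eq_le I_ge0// andbT leNgt; apply/negP => c0.
set c := I r0 in c0.
pose N r := zint (fun z => r * r * H r z).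
pose N1 r z := (1 * r + r * 1) * H r z + r * r * H1 r z.
have CN := C1_mul _ _ _ _ _ _ (C1_mul _ _ _ _ _ _ (@C1_r R) C1_r) CH.
have dN r : 0 < r -> is_derive r 1 N (zint (N1 r)).
  by move=> rp; exact: (is_derive_zint _ _ _ r CN rp).
have cuH : cont2 (fun r z => r * (u r z * H r z)).
  by apply: cont2_mul; [exact: cont2_r|apply: cont2_mul => //; case: CH].
have cP : cont2 P by case: CP.
have N1_ge r : r0 <= r -> r * (c - 4 * pi * a r) <= zint (N1 r).
  move=> rr; have rp : 0 < r by exact: lt_le_trans rr.
  rewrite (@eq_zint _ (N1 r) (fun z => r * (P r z + r * (u r z * H r z)))); last first.
    by move=> z _; rewrite /N1 /P; ring.
  have cs : continuous (fun z => P r z + r * (u r z * H r z)).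
    exact: (cont2_slice _ _ rp (cont2_add _ _ cP cuH)).
  rewrite zint_scale// ler_pM2l// zint_add; last 2 first.
  - exact: (cont2_slice _ _ rp cP).
  - exact: (cont2_slice _ _ rp cuH).
  apply: lerD; first exact: I_le.
  rewrite lerNl; apply: le_trans (zint_uom_le r rp).
  apply: le_trans (ler_norm _) _; rewrite normrN.
  apply: le_trans (zint_norm _ (cont2_slice _ _ rp cuH)) _.
  apply: zint_le.
  - exact: (cont2_slice _ _ rp (cont2_norm _ cuH)).
  - by apply: (cont2_slice (fun r z => `|u r z| * `|om r z|)) => //;
      apply: cont2_mul; exact: cont2_norm.
  by move=> z _; exact: ruH_le.
have N_le r : 0 < r -> N r <= r * (2 * pi + 2 * a r).
  move=> rp.
  apply: (@le_trans _ _ (r * zint (fun z => `|om r z|))); last first.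
    by rewrite ler_pM2l//; exact: zint_om_le.
  rewrite -zint_scale; last exact: (cont2_slice _ _ rp (cont2_norm _ com)).
  apply: zint_le.
  - by apply: (cont2_slice (fun r z => r * r * H r z)) => //; case: CN.
  - by move=> z; apply: cvgM; [exact: cvg_cst|exact: (cont2_slice _ _ rp (cont2_norm _ com))].
  by move=> z _; rewrite -mulrA ler_pM2l//; exact: rH_le.
pose M r := N r + 4 * pi * A r - c / 2 * (r * r).
have M_le r : r0 <= r -> M r0 <= M r.
  move=> rr.
  apply: (derive_ge0_le M
    (fun t => zint (N1 t) + 4 * pi * (t * a t) - c / 2 * (1 * t + t * 1))) => //.
    move=> x /andP[x1 _]; have x0 : 0 < x by exact: lt_le_trans x1.
    apply: is_derive_sub.
      by apply: is_derive_add; [exact: dN|apply: is_derive_scale; exact: dA].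
    apply: is_derive_scale; exact: (is_derive_mul id id).
  move=> x /andP[x1 _]; have := N1_ge x x1; lra.
have k0 : 0 < 4 * (pi : R) by rewrite mulr_gt0.
have [C hC] := A_small (c / (4 * (4 * pi))) (divr_gt0 c0 (mulr_gt0 (ltr0n _ 4) k0)).
pose c1 := 4 * pi * C - M r0.
have big r : r0 <= r -> c * r ^+ 2 / 4 - c1 <= r * (2 * pi + 2 * a r).
  move=> rr; have rp : 0 < r by exact: lt_le_trans rr.
  apply: le_trans (N_le r rp).
  have h1 := M_le r rr; rewrite /M -/(M r0) in h1.
  have h2 : 4 * pi * A r <= c / 4 * r ^+ 2 + 4 * pi * C.
    have := hC r rp; rewrite -(ler_pM2l k0) => h; apply: le_trans h _.
    have kE (k : R) : 0 < k -> k * (c / (4 * k) * r ^+ 2) = c / 4 * r ^+ 2.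
      by move=> k_gt0; field; rewrite gt_eqF.
    by rewrite mulrDr kE.
  rewrite /c1 expr2; rewrite expr2 in h2; lra.
(* For r >= X, the bound in big is incompatible with a(r) < 1. *)
pose X := 4 * (2 * pi + 2 + `|c1|) / c.
have X0 : 0 <= X by rewrite divr_ge0 ?(ltW c0)// mulr_ge0// !addr_ge0// mulr_ge0// ltW.
apply: (energy_not_bounded_below 1 (r0 + 1 + X)) => //; first by lra.
move=> r rr.
have r1 : 1 <= r by lra.
have rX : X <= r by lra.
have rr0 : r0 <= r by lra.
rewrite leNgt; apply/negP => a1.
have h1 := big r rr0.
have h2 : c1 <= `|c1| * r.
  by rewrite (le_trans (ler_norm c1))// ler_peMr.
have h3 : r * a r < r * 1 by rewrite ltr_pM2l//; lra.
have h4 : r * (4 * (2 * pi + 2 + `|c1|)) <= c * r * r.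
  have Xc : X <= r := rX; rewrite /X ler_pdivrMr// in Xc.
  by rewrite [leRHS](_ : _ = r * (r * c)); [rewrite ler_pM2l//; lra|ring].
rewrite expr2 in h1; lra.
Qed.

(** As I vanishes identically, so does its derivative, the dissipation. Hence
   om / r is independent of r, and om grows linearly in r unless it vanishes. *)
Lemma om_eq0 r z : 0 < r -> - pi <= z <= pi -> om r z = 0.
Proof.
have zintD0 s : 0 < s -> zint (D s) = 0.
  move=> s0; have := dI s s0; have d0 := is_derive_const (0 : R) s.
  by move=> d; apply: (is_derive_unique I (fun=> 0) _ _ s s0 _ d d0); exact: I_eq0.
have Om10 s y : 0 < s -> - pi <= y <= pi -> Om1 s y = 0.
  move=> s0 ypi.
  have : D s y = 0.
    apply: (zint_eq0 (D s)) => //; [exact: cont2_slice| |exact: zintD0].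
    by move=> t _; exact: D_ge0.
  move/eqP; rewrite mulf_eq0 gt_eqF/=; last by apply: mulr_gt0; rewrite ?profile''_gt0.
  by rewrite paddr_eq0 ?sqr_ge0// sqrf_eq0 => /andP[/eqP].
have OmE s y : 0 < s -> - pi <= y <= pi -> om s y = s * om 1 y.
  move=> s0 ypi.
  have : Om s y = Om 1 y.
    apply: (derive0_const (Om ^~ y)) => // t t0.
    rewrite -(Om10 t y t0 ypi); by case: COm => _ _ _ d _; exact: d.
  by rewrite /Om divr1 => <-; field; rewrite gt_eqF.
move=> r0 zpi.
have com1 : continuous (om 1) by apply: cont2_slice.
have com12 : continuous (fun z => om 1 z ^+ 2) by move=> y; apply: cvgM; exact: com1.
have m0 : zint (fun z => om 1 z ^+ 2) = 0.
  apply/eqP; rewrite eq_le zint_ge0 ?andbT; last by move=> y _; exact: sqr_ge0.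
  rewrite leNgt; apply/negP => m0; set m := zint _ in m0.
  apply: (energy_not_bounded_below (m / 2) 1) => //; first by lra.
  move=> s s1; have s0 : 0 < s by lra.
  have := a_ge_om s s0.
  rewrite (@eq_zint _ _ (fun z => s ^+ 2 * om 1 z ^+ 2)); last first.
    by move=> y ypi; rewrite OmE// exprMn.
  rewrite zint_scale// -/m.
  have : m <= s ^+ 2 * m.
    by rewrite ler_peMl ?(ltW m0)// expr2; nra.
  lra.
rewrite OmE//.
have /eqP : om 1 z ^+ 2 = 0.
  by apply: (zint_eq0 _ com12) => // y _; exact: sqr_ge0.
by rewrite sqrf_eq0 => /eqP ->; rewrite mulr0.
Qed.

(** Without vorticity u satisfies u_rr + u_r / r - u / r^2 + u_zz = 0. Multiplied
   by r u and integrated over a period, this makes the integral of r u u_r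
   nondecreasing, hence nonnegative as it vanishes at the axis. So the integral
   of u^2 is nondecreasing in r; but it is bounded by the slice energy. *)
Lemma u_eq0 r z : 0 < r -> - pi <= z <= pi -> u r z = 0.
Proof.
have div1 s y : 0 < s -> 2 * u1 s y + s * u11 s y + w2 s y + s * w12 s y = 0.
  move=> s0.
  have [_ _ _ d _] := C1_add _ _ _ _ _ _ (C1_add _ _ _ _ _ _ Cu
    (C1_mul _ _ _ _ _ _ C1_r Cu1)) (C1_mul _ _ _ _ _ _ C1_r Cw2).
  have e := is_derive_unique _ (fun=> 0) _ 0 s s0 (div_free^~ y)
    (d s y s0) (is_derive_const _ _).
  by rewrite -[RHS]e; ring.
pose F s y := s * u1 s y ^+ 2 + u s y ^+ 2 / s + s * u2 s y ^+ 2.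
have cF : cont2 F.
  apply: cont2_add; [apply: cont2_add|]; apply: cont2_mul; try exact: cont_sq.
  - exact: cont2_r.
  - exact: cont2_inv.
  - exact: cont2_r.
pose I2 s := zint (fun y => s * u s y * u1 s y).
have C2 := C1_mul _ _ _ _ _ _ (C1_mul _ _ _ _ _ _ (@C1_r R) Cu) Cu1.
have dI2 s : 0 < s -> is_derive s 1 I2 (zint (F s)).
  move=> s0; apply: is_derive_eq (is_derive_zint _ _ _ s C2 s0) _.
  have Cwu := C1_mul _ _ _ _ _ _ Cw1 Cu.
  have cwu : continuous (fun y => w12 s y * u s y + w1 s y * u2 s y).
    by case: Cwu => _ _ c _ _; exact: (cont2_slice _ _ s0 c).
  transitivity (zint (fun y => F s y - s * (w12 s y * u s y + w1 s y * u2 s y))).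
    apply: eq_zint => y ypi.
    have e : u2 s y = w1 s y by apply/eqP; rewrite -subr_eq0 -omE// om_eq0.
    have sn0 : s != 0 by rewrite gt_eqF.
    have e1 := div1 s y s0; have e2 := div_free s y s0.
    have -> : w12 s y = - (2 * u1 s y + s * u11 s y + w2 s y) / s.
      by apply: (mulfI sn0); rewrite mulrCA mulfV// mulr1; lra.
    have -> : w2 s y = - (u s y + s * u1 s y) / s.
      by apply: (mulfI sn0); rewrite mulrCA mulfV// mulr1; lra.
    by rewrite /F -e; field; rewrite gt_eqF.
  rewrite zint_sub; [|exact: cont2_slice|]; last first.
    by move=> y; apply: cvgM; [exact: cvg_cst|exact: cwu].
  rewrite zint_scale// (zint_FTC _ _ _ _ Cwu s0).
  by rewrite !(per_pi _ per_w1)// !(per_pi _ per_u)// subrr mulr0 subr0.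
have I2_ge0 s : 0 < s -> 0 <= I2 s.
  apply: (derive_ge0_ge0 I2 (fun s => zint (F s)) (K * K * (2 * pi))) => // t.
    move=> t0; apply: zint_ge0 => y _.
    by rewrite !addr_ge0// mulr_ge0 ?sqr_ge0// ?invr_ge0 ltW.
  move=> t01; have /andP[t0 t1] := t01.
  rewrite [leLHS](_ : _ = zint (fun=> - (K * K * t))); last by rewrite zint_cst; ring.
  apply: zint_le.
  - by move=> y; exact: cvg_cst.
  - by case: C2 => c _ _ _ _; exact: (cont2_slice _ _ t0 c).
  move=> y ypi; have [uK u1K _ _] := axis t y t01 ypi.
  rewrite lerNl (le_trans (ler_norm _))// normrN !normrM (gtr0_norm t0).
  by rewrite -mulrA mulrC ler_pM2r// ler_pM.
pose U s := zint (fun y => u s y * u s y).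
have CU := C1_mul _ _ _ _ _ _ Cu Cu.
have dU s : 0 < s -> is_derive s 1 U (2 / s * I2 s).
  move=> s0; apply: is_derive_eq (is_derive_zint _ _ _ s CU s0) _.
  rewrite /I2 -zint_scale; last by case: C2 => c _ _ _ _; exact: (cont2_slice _ _ s0 c).
  by apply: eq_zint => y _; field; rewrite gt_eqF.
have U_le s : r <= s -> 0 < r -> U r <= U s.
  move=> rs r0; apply: (derive_ge0_le U (fun s => 2 / s * I2 s)) => // x /andP[rx _].
    by apply: dU; exact: lt_le_trans rx.
  have x0 : 0 < x by exact: lt_le_trans rx.
  by rewrite mulr_ge0 ?I2_ge0// divr_ge0// ltW.
move=> r0 zpi.
have cuu : continuous (fun y => u r y * u r y).
  by case: CU => c _ _ _ _; exact: (cont2_slice _ _ r0 c).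
have usq_ge0 y : 0 <= u r y * u r y by rewrite -expr2 sqr_ge0.
have U0 : U r = 0.
  apply/eqP; rewrite eq_le zint_ge0 ?andbT// leNgt; apply/negP => Ur.
  have p2 : 0 < 8 * (pi : R) ^+ 2 by rewrite mulr_gt0// exprn_gt0.
  apply: (energy_not_bounded_below (U r / (8 * pi ^+ 2)) r) => //; first by rewrite divr_gt0.
  move=> s rs; rewrite ler_pdivrMr// mulrC; apply: le_trans (U_le s rs r0) _.
  have s0 : 0 < s by exact: lt_le_trans rs.
  by apply: le_trans (zint_usq_le s s0); rewrite /U (@eq_zint _ _ (fun z => u s z ^+ 2)).
have /eqP := zint_eq0 _ cuu (fun y _ => usq_ge0 y) U0 z zpi.
by rewrite mulf_eq0 orbb => /eqP.
Qed.

Let per_eq0 (f : R -> R -> R) : (forall r z : R, 0 < r -> f r (z + 2 * pi) = f r z) ->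
  (forall r z, 0 < r -> - pi <= z <= pi -> f r z = 0) ->
  forall r z, 0 < r -> f r z = 0.
Proof.
move=> pf f0 r z r0.
have nat_shift (n : nat) y : f r (y + n%:R * (2 * pi)) = f r y.
  elim: n y => [|n IH] y; first by rewrite mul0r addr0.
  have -> : y + n.+1%:R * (2 * pi) = y + n%:R * (2 * pi) + 2 * pi.
    by rewrite -natr1 mulrDl mul1r addrA.
  by rewrite pf.
have int_shift (k : int) y : f r (y + k%:~R * (2 * pi)) = f r y.
  case: k => n; first exact: nat_shift.
  have := nat_shift n.+1 (y - n.+1%:R * (2 * pi)).
  by rewrite subrK NegzE mulrNz mulNr => ->.
pose k := Num.floor ((z + pi) / (2 * pi)).
have /andP[k1 k2] := real_floor_itv (num_real ((z + pi) / (2 * pi))).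
rewrite -(int_shift (- k)); apply: f0 => //.
move: k1 k2; rewrite -/k ler_pdivlMr ?mulr_gt0// ltr_pdivrMr ?mulr_gt0//.
rewrite intrD mulrNz; move: (k%:~R : R) => q; rewrite mulNr mulrDl => k1 k2.
by apply/andP; split; lra.
Qed.

Theorem meridional_liouville r z : 0 < r -> u r z = 0 /\ w r z = w 1 0.
Proof.
have u0 := per_eq0 _ per_u u_eq0.
have om0 := per_eq0 _ per_om om_eq0.
have u20 s y : 0 < s -> u2 s y = 0.
  move=> s0; have [_ _ _ _ d] := Cu; have [_ <-] := d s y s0.
  have -> : u s = (fun=> 0) by apply/funext => t; exact: u0.
  exact: derive_cst.
have w10 s y : 0 < s -> w1 s y = 0.
  by move=> s0; have := omE s y s0; rewrite om0// u20// => ?; lra.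
have u10 s y : 0 < s -> u1 s y = 0.
  move=> s0; have [_ _ _ d _] := Cu.
  by apply: (is_derive_unique (u ^~ y) (fun=> 0) _ _ s s0 _ (d s y s0)
    (is_derive_const _ _)) => t; exact: u0.
have w20 s y : 0 < s -> w2 s y = 0.
  move=> s0; have := div_free s y s0; rewrite u0// u10// mulr0 !add0r.
  by move/eqP; rewrite mulf_eq0 gt_eqF//= => /eqP.
move=> r0; split; first exact: u0.
have -> : w r z = w 1 z.
  apply: (derive0_const (w ^~ z)) => // t t0; rewrite -(w10 t z t0).
  by case: Cw => _ _ _ d _; exact: d.
apply: is_derive_0_is_cst => y; rewrite -(w20 1 y ltr01).
by case: Cw => _ _ _ _; exact.
Qed.

End MeridionalFlow.

(** * Smooth functions on space *)

Section SmoothFields.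
Local Open Scope classical_set_scope.
Local Open Scope ring_scope.
Context {R : realType}.
Implicit Types (f g : 'rV[R]_3 -> R) (x : 'rV[R]_3) (a b c r s t y z : R).

Lemma sum3 (V : nmodType) (F : 'I_3 -> V) : \sum_(i < 3) F i = F 0 + F 1 + F 2.
Proof.
rewrite !big_ord_recl big_ord0 addr0 addrA.
by congr (_ + _ + _); congr (F _); apply: val_inj.
Qed.

Lemma pt0 a b c : pt a b c 0 0 = a. Proof. by rewrite mxE. Qed.
Lemma pt1 a b c : pt a b c 0 1 = b. Proof. by rewrite mxE. Qed.
Lemma pt2 a b c : pt a b c 0 2 = c. Proof. by rewrite mxE. Qed.
Definition ptE := (pt0, pt1, pt2).

Lemma rV3P (x x' : 'rV[R]_3) :
  x 0 0 = x' 0 0 -> x 0 1 = x' 0 1 -> x 0 2 = x' 0 2 -> x = x'.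
Proof.
move=> e0 e1 e2; apply/rowP => -[[|[|[|//]]] i].
- by rewrite (_ : Ordinal i = 0)//; apply: val_inj.
- by rewrite (_ : Ordinal i = 1)//; apply: val_inj.
- by rewrite (_ : Ordinal i = 2)//; apply: val_inj.
Qed.

Lemma pt_eta x : pt (x 0 0) (x 0 1) (x 0 2) = x.
Proof. by apply: rV3P; rewrite ptE. Qed.

Let e_ (i : 'I_3) : 'rV[R]_3 := delta_mx 0 i.

Lemma pt_comb a b c : pt a b c = a *: e_ 0 + b *: e_ 1 + c *: e_ 2.
Proof. by apply: rV3P; rewrite ptE /e_ !mxE /=; ring. Qed.

Lemma class_C_continuous k f : class_C k f -> continuous f.
Proof.
by case: k => // k [df _] x; exact: differentiable_continuous.
Qed.

Lemma smooth_partial f i : smooth f -> smooth (partial i f).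
Proof. by move=> sf k; have [_] := sf k.+1; exact. Qed.

Lemma smooth_continuous f : smooth f -> continuous f.
Proof. by move=> sf; exact: (class_C_continuous 0 f (sf 0)). Qed.

Lemma is_derive_partial f i x : smooth f -> is_derive x (e_ i) f (partial i f x).
Proof.
by move=> sf; apply: DeriveDef => //; apply: diff_derivable; case: (sf 1).
Qed.

Lemma is_derive_line f x (v : 'rV[R]_3) (d s : R) : is_derive (s *: v + x) v f d ->
  is_derive s 1 (fun t => f (t *: v + x)) d.
Proof.
move=> [df <-].
have H : (fun h : R => h^-1 *: (((fun t => f (t *: v + x)) \o shift s) (h *: 1) -
    f (s *: v + x))) =
  (fun h : R => h^-1 *: ((f \o shift (s *: v + x)) (h *: v) - f (s *: v + x))).
  by apply/funext => h /=; rewrite [h%:A]mulr1 scalerDl addrA.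
apply: DeriveDef; first by rewrite /derivable H.
by rewrite /derive H.
Qed.

Lemma is_derive_pt0 f a b c : smooth f ->
  is_derive a 1 (fun t => f (pt t b c)) (partial 0 f (pt a b c)).
Proof.
move=> sf.
have E t : pt t b c = t *: e_ 0 + pt 0 b c by apply: rV3P; rewrite /e_ !mxE /=; ring.
rewrite (_ : (fun t => _) = (fun t => f (t *: e_ 0 + pt 0 b c))).
  by apply: is_derive_line; rewrite -E; exact: is_derive_partial.
by apply/funext => t; rewrite E.
Qed.

Lemma is_derive_pt1 f a b c : smooth f ->
  is_derive b 1 (fun t => f (pt a t c)) (partial 1 f (pt a b c)).
Proof.
move=> sf.
have E t : pt a t c = t *: e_ 1 + pt a 0 c by apply: rV3P; rewrite /e_ !mxE /=; ring.
rewrite (_ : (fun t => _) = (fun t => f (t *: e_ 1 + pt a 0 c))).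
  by apply: is_derive_line; rewrite -E; exact: is_derive_partial.
by apply/funext => t; rewrite E.
Qed.

Lemma is_derive_pt2 f a b c : smooth f ->
  is_derive c 1 (fun t => f (pt a b t)) (partial 2 f (pt a b c)).
Proof.
move=> sf.
have E t : pt a b t = t *: e_ 2 + pt a b 0 by apply: rV3P; rewrite /e_ !mxE /=; ring.
rewrite (_ : (fun t => _) = (fun t => f (t *: e_ 2 + pt a b 0))).
  by apply: is_derive_line; rewrite -E; exact: is_derive_partial.
by apply/funext => t; rewrite E.
Qed.

Lemma cont_comb f (x v w : 'rV[R]_3) a b : continuous f ->
  cont2_at (fun s t => f (s *: v + t *: w + x)) a b.
Proof.
move=> cf.
apply: (@continuous_comp _ _ _ (fun p : R * R => p.1 *: v + p.2 *: w + x) f);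
  last exact: cf.
apply: cvgD; last exact: cvg_cst.
by apply: cvgD; apply: cvgZ; try exact: cvg_cst; [exact: cvg_fst|exact: cvg_snd].
Qed.

Definition meridian f : R -> R -> R := fun r z => f (pt r 0 z).

Lemma cont_meridian f r z : continuous f -> cont2_at (meridian f) r z.
Proof.
move=> cf; have := cont_comb f 0 (e_ 0) (e_ 2) r z cf.
rewrite (_ : (fun s t => f _) = meridian f)//.
by apply/funext => s; apply/funext => t; rewrite /meridian pt_comb scale0r !addr0.
Qed.

Lemma C1_meridian f : smooth f ->
  C1 (meridian f) (meridian (partial 0 f)) (meridian (partial 2 f)).
Proof.
move=> sf; split.
- by move=> r z _; apply: cont_meridian; exact: smooth_continuous.
- by move=> r z _; apply: cont_meridian; apply: smooth_continuous; exact: smooth_partial.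
- by move=> r z _; apply: cont_meridian; apply: smooth_continuous; exact: smooth_partial.
- by move=> r z _; exact: is_derive_pt0.
- by move=> r z _; exact: is_derive_pt2.
Qed.

(** Both mixed derivatives are limits of the same second difference quotient,
   by the mean value theorem applied in either order. *)
Lemma mixed_derivatives_eq (F F1 F2 F12 F21 : R -> R -> R) a b :
  (forall s t, is_derive s 1 (F ^~ t) (F1 s t)) ->
  (forall s t, is_derive t 1 (F s) (F2 s t)) ->
  (forall s t, is_derive t 1 (F1 s) (F12 s t)) ->
  (forall s t, is_derive s 1 (F2 ^~ t) (F21 s t)) ->
  cont2_at F12 a b -> cont2_at F21 a b -> F12 a b = F21 a b.
Proof.
move=> d1 d2 d12 d21 c12 c21.
have close (G : R -> R -> R) (e : R) : 0 < e -> cont2_at G a b -> exists2 h : R, 0 < h &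
    forall s t, a <= s <= a + h -> b <= t <= b + h -> `|G a b - G s t| < e.
  move=> e0 /cvgrPdist_lt /(_ e e0) /nbhs_ballP [h /= h0 hh].
  exists (h / 2); first by rewrite divr_gt0.
  move=> s t /andP[s1 s2] /andP[t1 t2]; apply: (hh (s, t)).
  by split; rewrite /ball/= ltr_norml; apply/andP; split => /=; lra.
apply/eqP; rewrite -subr_eq0 -normr_le0; apply/ler_addgt0Pr => e e0; rewrite add0r.
have e20 : 0 < e / 2 by rewrite divr_gt0.
have [h1 h10 H1] := close _ _ e20 c12.
have [h2 h20 H2] := close _ _ e20 c21.
pose h := Num.min h1 h2.
have h0 : 0 < h by rewrite lt_min h10.
have hh1 : h <= h1 by rewrite ge_min lexx.
have hh2 : h <= h2 by rewrite ge_min lexx orbT.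
have [|s /andP[s1 s2] Es] := MVT_derive (fun s => F s (b + h) - F s b)
    (fun s => F1 s (b + h) - F1 s b) a (a + h) _
    (fun s => is_derive_sub _ _ _ _ _ (d1 s _) (d1 s _)).
  by rewrite ltrDl.
have [|t /andP[t1 t2] Et] := MVT_derive (F1 s) (F12 s) b (b + h) _ (d12 s).
  by rewrite ltrDl.
have [|t' /andP[t1' t2'] Et'] := MVT_derive (fun t => F (a + h) t - F a t)
    (fun t => F2 (a + h) t - F2 a t) b (b + h) _
    (fun t => is_derive_sub _ _ _ _ _ (d2 _ t) (d2 _ t)).
  by rewrite ltrDl.
have [|s' /andP[s1' s2'] Es'] := MVT_derive (F2 ^~ t') (F21 ^~ t') a (a + h) _ (d21 ^~ t').
  by rewrite ltrDl.
have E : F12 s t = F21 s' t'.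
  rewrite Et in Es; rewrite Es' in Et'.
  have hn : h != 0 by rewrite gt_eqF.
  apply: (mulIf hn); apply: (mulIf hn).
  have ha : a + h - a = h by ring.
  have hb : b + h - b = h by ring.
  rewrite ha hb in Es Et'; rewrite -Es -Et'; ring.
have A1 : `|F12 a b - F12 s t| < e / 2.
  by apply: H1; apply/andP; split; lra.
have A2 : `|F21 a b - F21 s' t'| < e / 2.
  by apply: H2; apply/andP; split; lra.
rewrite E in A1; move: A1 A2; rewrite !ltr_norml ler_norml => /andP[??] /andP[??].
by apply/andP; split; lra.
Qed.

Lemma partial_comm f i j : smooth f -> partial i (partial j f) = partial j (partial i f).
Proof.
move=> sf; apply/funext => x.
pose F (g : 'rV[R]_3 -> R) s t := g (s *: e_ i + t *: e_ j + x).
have d1 g : smooth g -> forall s t, is_derive s 1 (F g ^~ t) (F (partial i g) s t).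
  move=> sg s t; rewrite /F (_ : (fun s => _) = (fun s => g (s *: e_ i + (t *: e_ j + x)))).
    by apply: is_derive_line; rewrite -addrA; exact: is_derive_partial.
  by apply/funext => ?; rewrite addrA.
have d2 g : smooth g -> forall s t, is_derive t 1 (F g s) (F (partial j g) s t).
  move=> sg s t; rewrite /F (_ : (fun t => _) = (fun t => g (t *: e_ j + (s *: e_ i + x)))).
    by apply: is_derive_line; rewrite addrCA addrA; exact: is_derive_partial.
  by apply/funext => ?; rewrite addrCA addrA.
have E g : g x = F g 0 0 by rewrite /F !scale0r !add0r.
have cF g : smooth g -> cont2_at (F g) 0 0.
  by move=> sg; apply: cont_comb; exact: smooth_continuous.
have si := smooth_partial _ i sf; have sj := smooth_partial _ j sf.
rewrite [LHS]E [RHS]E; apply/esym.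
exact: (mixed_derivatives_eq (F f) (F (partial i f)) (F (partial j f))
  (F (partial j (partial i f))) (F (partial i (partial j f))) 0 0
  (d1 f sf) (d2 f sf) (d2 _ si) (d1 _ sj)
  (cF _ (smooth_partial _ j si)) (cF _ (smooth_partial _ i sj))).
Qed.

Lemma partial_comm3 f i j : smooth f ->
  partial j (partial i (partial i f)) = partial i (partial i (partial j f)).
Proof.
move=> sf; have si := smooth_partial _ i sf.
exact: (etrans (partial_comm (partial i f) j i si)
  (congr1 (partial i) (partial_comm f j i sf))).
Qed.

Lemma partial_periodic f i (T : 'rV[R]_3) : (forall x, f (x + T) = f x) ->
  forall x, partial i f (x + T) = partial i f x.
Proof.
move=> pf x; have E : (fun h : R => h^-1 *: ((f \o shift (x + T)) (h *: e_ i) - f (x + T))) =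
    (fun h : R => h^-1 *: ((f \o shift x) (h *: e_ i) - f x)).
  by apply/funext => h /=; rewrite addrA !pf.
by rewrite /partial /derive E.
Qed.

(** A shifted copy of the meridional plane brings the axis, and any half-plane
   beyond it, into the domain r > 0 of [C1]. *)
Lemma C1_meridian_shift f c : smooth f -> C1 (fun r z => meridian f (r - c) z)
  (fun r z => meridian (partial 0 f) (r - c) z) (fun r z => meridian (partial 2 f) (r - c) z).
Proof.
move=> sf.
have cc g : smooth g -> cont2 (fun r z => meridian g (r - c) z).
  move=> sg r z _.
  have := cont_comb g (- c *: delta_mx 0 0) (delta_mx 0 0) (delta_mx 0 2) r z
    (smooth_continuous _ sg).
  rewrite (_ : (fun s t => g _) = (fun r z => meridian g (r - c) z))//.
  apply/funext => s; apply/funext => t; rewrite /meridian pt_comb scale0r addr0 scalerBl scaleNr.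
  by rewrite addrAC.
split.
- exact: cc.
- by apply: cc; exact: smooth_partial.
- by apply: cc; exact: smooth_partial.
- move=> r z _.
  have d := is_derive_chain (meridian f ^~ z) (fun r => r - c) _ _ r
    (is_derive_pt0 f (r - c) 0 z sf)
    (is_derive_sub _ _ _ _ r (is_derive_id r 1) (is_derive_const c r)).
  by apply: is_derive_eq d _; rewrite subr0 mulr1.
- by move=> r z _; exact: is_derive_pt2.
Qed.

(** The shift by c moves s into the half-line where integrals over a period can
   be differentiated. *)
Lemma continuous_zint_sum_sq f g : smooth f -> smooth g ->
  continuous (fun s => zint (fun z => meridian f s z ^+ 2 + meridian g s z ^+ 2)).
Proof.
move=> sf sg s; pose c := `|s| + 1.
have r0 : 0 < s + c by have := ler_norm (- s); rewrite normrN /c; lra.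
have Cf := C1_meridian_shift f c sf; have Cg := C1_meridian_shift g c sg.
have Csq := C1_add _ _ _ _ _ _ (C1_mul _ _ _ _ _ _ Cf Cf) (C1_mul _ _ _ _ _ _ Cg Cg).
have h := is_derive_continuous _ _ _ (is_derive_zint _ _ _ (s + c) Csq r0).
have cs : {for s, continuous (fun t => t + c)} by apply: cvgD; [exact: cvg_id|exact: cvg_cst].
have := @continuous_comp _ _ _ (fun t => t + c)
  (fun r => zint (fun z => meridian f (r - c) z * meridian f (r - c) z +
    meridian g (r - c) z * meridian g (r - c) z)) s cs h.
rewrite (_ : _ \o _ = (fun s => zint (fun z => meridian f s z ^+ 2 + meridian g s z ^+ 2)))//.
by apply/funext => t /=; rewrite addrK.
Qed.

Lemma continuous_grad_norm (v : 'rV[R]_3 -> 'rV[R]_3) : smooth_field v ->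
  continuous (grad_norm v).
Proof.
move=> hv x.
have c i j : {for x, continuous (fun y : 'rV[R]_3 => partial j (vcomp v i) y ^+ 2)}.
  have cp : {for x, continuous (partial j (vcomp v i))}.
    by apply: smooth_continuous; apply: smooth_partial; exact: hv.
  by apply: (cvgM cp cp).
have cD (g h : 'rV[R]_3 -> R) : {for x, continuous g} -> {for x, continuous h} ->
    {for x, continuous (fun y : 'rV[R]_3 => g y + h y)}.
  by move=> cg ch; exact: (cvgD cg ch).
have -> : grad_norm v = Num.sqrt \o (fun x : 'rV[R]_3 =>
  (partial 0 (vcomp v 0) x ^+ 2 + partial 1 (vcomp v 0) x ^+ 2 + partial 2 (vcomp v 0) x ^+ 2) +
  (partial 0 (vcomp v 1) x ^+ 2 + partial 1 (vcomp v 1) x ^+ 2 + partial 2 (vcomp v 1) x ^+ 2) +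
  (partial 0 (vcomp v 2) x ^+ 2 + partial 1 (vcomp v 2) x ^+ 2 + partial 2 (vcomp v 2) x ^+ 2)).
  by apply/funext => y; rewrite /grad_norm /= !sum3.
apply: continuous_comp; last exact: sqrt_continuous.
have c3 i := cD _ _ (cD _ _ (c i 0) (c i 1)) (c i 2).
exact: (cD _ _ (cD _ _ (c3 0) (c3 1)) (c3 2)).
Qed.

Lemma shift_periodic f : (forall a b c, f (pt a b (c + 2 * pi)) = f (pt a b c)) ->
  forall x : 'rV[R]_3, f (x + pt 0 0 (2 * pi)) = f x.
Proof.
move=> pf x; rewrite -[in RHS](pt_eta x) -pf; congr f.
by apply: rV3P; rewrite mxE !ptE ?addr0.
Qed.

End SmoothFields.

(** * From the space integral to the growth of the meridional energy *)

Section EnergyGrowth.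
Local Open Scope classical_set_scope.
Local Open Scope ring_scope.
Context {R : realType}.
Implicit Types (a b c d e r s x y z : R).
Notation mu := (@lebesgue_measure R).

(** F is the pointwise limit of its values at the left grid points
   floor(n z) / n, and these are countable patchworks of the measurable functions
   F(., k / n). *)
Lemma caratheodory_measurable (disp : measure_display) (T : measurableType disp)
    (F : T -> R -> R) :
  (forall z, measurable_fun setT (F ^~ z)) -> (forall t, continuous (F t)) ->
  measurable_fun setT (fun p : T * measurableTypeR R => F p.1 p.2).
Proof.
move=> mF cF.
pose g (n : nat) (p : T * measurableTypeR R) :=
  F p.1 ((Num.floor (n.+1%:R * (p.2 : R)))%:~R / n.+1%:R).
apply: (measurable_fun_cvg (h := g)) => [n|[t z] _ /=].
- move=> _ Y mY; rewrite setTI.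
  have -> : g n @^-1` Y = \bigcup_(k : int)
      (((F ^~ (k%:~R / n.+1%:R)) @^-1` Y) `*` `[k%:~R / n.+1%:R, (k%:~R + 1) / n.+1%:R[%classic).
    have n0 : 0 < n.+1%:R :> R by [].
    apply/seteqP; split => [[t z] /= Yg|[t z] [k _] /= [Yk]].
      exists (Num.floor (n.+1%:R * (z : R))) => //=; split => //.
      have /andP[h1 h2] := real_floor_itv (num_real (n.+1%:R * (z : R))).
      rewrite intrD in h2.
      by rewrite in_itv/= ler_pdivrMr// ltr_pdivlMr// ![(z : R) * _]mulrC h1 h2.
    rewrite in_itv/= ler_pdivrMr// ltr_pdivlMr// => /andP[h1 h2].
    rewrite /g /= (_ : Num.floor _ = k)//; apply: floor_def.
    by rewrite intrD ![_%:R * (z : R)]mulrC h1 h2.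
  apply: countable_bigcupT_measurable => // k; apply: measurableX => //.
  by rewrite -[X in measurable X]setTI; exact: mF.
- suff lim_z : (Num.floor (n.+1%:R * (z : R)))%:~R / n.+1%:R @[n --> \oo] --> (z : R).
    exact: (cvg_comp _ (F t) lim_z (cF t z)).
  apply/cvgrPdist_lt => e e0.
  near=> n.
  have n0 : 0 < n.+1%:R :> R by [].
  have /andP[h1 h2] := real_floor_itv (num_real (n.+1%:R * (z : R))).
  rewrite intrD in h2.
  rewrite (@le_lt_trans _ _ n.+1%:R^-1)//; last first.
    by near: n; exact: near_infty_natSinv_lt (PosNum e0).
  move: h1 h2; set k := (Num.floor _)%:~R => h1 h2.
  have -> : (z : R) - k / n.+1%:R = (n.+1%:R * (z : R) - k) / n.+1%:R.
    by field; rewrite gt_eqF.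
  rewrite normrM (@ger0_norm _ n.+1%:R^-1) ?invr_ge0// ler_piMl ?invr_ge0//.
  by rewrite ler_norml; move/ltW : h2 => h2; apply/andP; split; lra.
Unshelve. all: by end_near. Qed.

Lemma pt_measurable (h : 'rV[R]_3 -> R) : continuous h ->
  measurable_fun setT (fun p : measurableTypeR R * measurableTypeR R * measurableTypeR R =>
    h (pt p.1.1 p.1.2 p.2)).
Proof.
move=> ch.
have c0 b c : continuous (fun t : R => h (pt t b c)).
  move=> t; apply: (@continuous_comp _ _ _ (fun t : R => pt t b c) h); last exact: ch.
  rewrite (_ : (fun t => _) = (fun t : R =>
    t *: delta_mx 0 0 + (b *: delta_mx 0 1 + c *: delta_mx 0 2))).
    by apply: cvgD; [apply: cvgZr_tmp; exact: cvg_id|exact: cvg_cst].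
  by apply/funext => s; rewrite pt_comb addrA.
have c1 a c : continuous (fun t : R => h (pt a t c)).
  move=> t; apply: (@continuous_comp _ _ _ (fun t : R => pt a t c) h); last exact: ch.
  rewrite (_ : (fun t => _) = (fun t : R =>
    t *: delta_mx 0 1 + (a *: delta_mx 0 0 + c *: delta_mx 0 2))).
    by apply: cvgD; [apply: cvgZr_tmp; exact: cvg_id|exact: cvg_cst].
  by apply/funext => s; rewrite pt_comb addrCA addrA.
have c2 a b : continuous (fun t : R => h (pt a b t)).
  move=> t; apply: (@continuous_comp _ _ _ (fun t : R => pt a b t) h); last exact: ch.
  rewrite (_ : (fun t => _) = (fun t : R =>
    t *: delta_mx 0 2 + (a *: delta_mx 0 0 + b *: delta_mx 0 1))).
    by apply: cvgD; [apply: cvgZr_tmp; exact: cvg_id|exact: cvg_cst].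
  by apply/funext => s; rewrite pt_comb addrC.
apply: (caratheodory_measurable _ _ (fun (p : measurableTypeR R * measurableTypeR R) z =>
  h (pt p.1 p.2 z))) => [z|[a b]]; last exact: c2.
apply: (caratheodory_measurable _ _ (fun (x : measurableTypeR R) y =>
  h (pt x y z))) => [y|x]; last exact: c1.
exact: continuous_measurable_fun.
Qed.

Lemma antiderivative (f : R -> R) (c : R) : continuous f ->
  exists F : R -> R, forall t : R, c < t -> is_derive t 1 F (f t).
Proof.
move=> cf; exists (fun t => \int[@lebesgue_measure R]_(s in `[c, t]) f s) => t ct.
have tt1 : t < t + 1 by rewrite ltrDl.
have [d e] := @continuous_FTC1_closed R f c t (t + 1) tt1
  (continuous_integrable f c (t + 1) cf) ct (cf t).
by apply: (DeriveDef d); exact: (etrans (esym (derive1E _ _)) e).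
Qed.

(** Where t^2 exceeds d, the factor (t^2 / d)^(q / 2 - 1) is at least 1. *)
Lemma sqr_le_powR (q d : R) : 2 <= q -> 0 < d ->
  exists2 C : R, 0 <= C & forall t : R, 0 <= t -> t ^+ 2 <= d + C * t `^ q.
Proof.
move=> q2 d0; have dp : 0 < d `^ (q / 2 - 1) by rewrite powR_gt0.
exists (d `^ (q / 2 - 1))^-1; first by rewrite invr_ge0 ltW.
move=> t t0; have [td|dt] := leP (t ^+ 2) d.
  by apply: le_trans td _; rewrite lerDl mulr_ge0 ?invr_ge0 ?(ltW dp)// powR_ge0.
apply: (@le_trans _ _ ((d `^ (q / 2 - 1))^-1 * t `^ q)); last by rewrite lerDr ltW.
rewrite mulrC ler_pdivlMr//.
have t20 : 0 < t ^+ 2 by exact: lt_trans dt.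
have -> : t `^ q = t ^+ 2 * (t ^+ 2) `^ (q / 2 - 1).
  have e : (t ^+ 2) `^ (1 + (q / 2 - 1)) = t ^+ 2 * (t ^+ 2) `^ (q / 2 - 1).
    by rewrite powRD ?powRr1 ?(ltW t20)// (gt_eqF t20) implybT.
  rewrite -e -(powR_mulrn 2 t0) -powRrM; congr (t `^ _).
  by rewrite addrC subrK mulrC divfK.
rewrite ler_pM2l// ge0_ler_powR// ?nnegrE ?(ltW d0) ?(ltW t20) ?(ltW dt)//; lra.
Qed.

Lemma EFin_integral_segment (f : R -> R) (a b : R) : {within `[a, b], continuous f} ->
  (\int[mu]_(x in `[a, b]) (f x)%:E)%E = (\int[mu]_(x in `[a, b]) f x)%:E.
Proof.
move=> cf; rewrite /Rintegral fineK//; apply: integrable_fin_num => //.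
by apply: continuous_compact_integrable => //; exact: segment_compact.
Qed.

(** One stage of the iterated integration in [energy_growth]. On the right the
   integral is over the whole line, so that the bound does not depend on the
   segment; k is extended real-valued because it is itself an integral. *)
Lemma integral_segment_le (a b c C : R) (phi : R -> R) (k : R -> \bar R) :
  a < b -> {within `[a, b], continuous phi} ->
  (forall x, a <= x <= b -> 0 <= phi x) -> 0 <= c -> 0 <= C ->
  measurable_fun setT k -> (forall x, 0 <= k x)%E ->
  (forall x, a <= x <= b -> ((phi x)%:E <= c%:E + C%:E * k x)%E) ->
  ((\int[mu]_(x in `[a, b]) phi x)%:E <= (c * (b - a))%:E + C%:E * \int[mu]_x k x)%E.
Proof.
move=> ab cphi phi0 c0 C0 mk k0 le.
have mab : measurable (`[a, b]%classic : set (measurableTypeR R)) by [].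
have mkab : measurable_fun (`[a, b]%classic : set (measurableTypeR R)) k.
  exact: measurable_funTS.
have mCk : measurable_fun (`[a, b]%classic : set (measurableTypeR R)) (fun x => C%:E * k x)%E.
  exact: measurable_funeM.
have Ck0 x : (0 <= C%:E * k x)%E by rewrite mule_ge0 ?lee_fin.
have mphi : measurable_fun (`[a, b]%classic : set (measurableTypeR R)) (EFin \o phi).
  have := @continuous_compact_integrable R phi `[a, b] (@segment_compact _ _ _) cphi.
  by case/integrableP.
rewrite -EFin_integral_segment//.
apply: (@le_trans _ _ (\int[mu]_(x in `[a, b]) (c%:E + C%:E * k x))%E).
  apply: ge0_le_integral => //.
  by apply: emeasurable_funD.
rewrite ge0_integralD//.
rewrite (EFin_integral_segment (fun=> c)); last first.
  by apply: continuous_subspaceT => x; exact: cvg_cst.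
rewrite integral_segment_cst// leeD2l// ge0_integralZl_EFin//.
by rewrite lee_pmul// ?lee_fin ?integral_ge0//; apply: ge0_subset_integral.
Qed.

Lemma continuous_hypot (x : R) : continuous (fun y : R => Num.sqrt (x ^+ 2 + y ^+ 2)).
Proof.
move=> y; apply: (@continuous_comp _ _ _ (fun y : R => x ^+ 2 + y ^+ 2) Num.sqrt).
  by apply: cvgD; [exact: cvg_cst|exact: exprn_continuous].
exact: sqrt_continuous.
Qed.

Lemma le_hypot (x y : R) : 0 <= y -> y <= Num.sqrt (x ^+ 2 + y ^+ 2).
Proof.
move=> y0; have : Num.sqrt (y ^+ 2) <= Num.sqrt (x ^+ 2 + y ^+ 2).
  by rewrite ler_sqrt ?lerDr ?addr_ge0 ?sqr_ge0.
by rewrite sqrtr_sqr ger0_norm.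
Qed.

(** A substitute for polar coordinates, one line at a time. As y runs over
   [0, r], s = sqrt (x ^+ 2 + y ^+ 2) runs over an interval containing [x, r], at
   speed y / s <= 1; Phi is a primitive of a. *)
Lemma line_integral_ge (a Phi : R -> R) (x r : R) : continuous a ->
  (forall s, 0 <= s -> 0 <= a s) -> (forall s, -1 < s -> is_derive s 1 Phi (a s)) ->
  0 <= x <= r -> 0 < r ->
  Phi r - Phi x <= \int[mu]_(y in `[0, r]) a (Num.sqrt (x ^+ 2 + y ^+ 2)).
Proof.
move=> ca a0 dPhi /andP[x0 xr] r0.
pose h (y : R) := Num.sqrt (x ^+ 2 + y ^+ 2).
have h0 y : 0 <= h y by exact: sqrtr_ge0.
have cah : continuous (fun y => a (h y)).
  by move=> y; apply: continuous_comp; [exact: continuous_hypot|exact: ca].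
have [T dT] := antiderivative (fun y => a (h y)) (-1) cah.
have E : \int[mu]_(y in `[0, r]) a (h y) = T r - T 0.
  have dT0 z : 0 <= z -> is_derive z 1 T (a (h z)) by move=> z0; apply: dT; lra.
  by apply: FTC_segment => //; [exact: continuous_subspaceT|
    move=> z /andP[z0 _]; exact: dT0].
rewrite -/h in E *; rewrite E.
have h00 : h 0 = x by rewrite /h expr0n/= addr0 sqrtr_sqr ger0_norm.
have rh : r <= h r.
  exact/le_hypot/ltW.
have Phi_mono : Phi r <= Phi (h r).
  apply: (derive_ge0_le Phi a) => // s /andP[rs _]; first by apply: dPhi; lra.
  by apply: a0; lra.
suff : T 0 - Phi (h 0) <= T r - Phi (h r) by rewrite h00; lra.
have [x_gt0|x_le0] := ltP 0 x.
  apply: (derive_ge0_le (fun y => T y - Phi (h y))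
    (fun y => a (h y) - a (h y) * (y / h y))) => //; last exact: ltW.
    move=> y /andP[y0 _].
    have p0 : 0 < x ^+ 2 + y ^+ 2 by rewrite ltr_pwDl ?exprn_gt0// sqr_ge0.
    apply: is_derive_sub; first by apply: dT; lra.
    apply: (is_derive_chain Phi h); last exact: is_derive_hypot.
    by apply: dPhi; rewrite (lt_le_trans _ (h0 y)).
  move=> y /andP[y0 _].
  have p0 : 0 < x ^+ 2 + y ^+ 2 by rewrite ltr_pwDl ?exprn_gt0// sqr_ge0.
  have hy : 0 < h y by rewrite sqrtr_gt0.
  rewrite subr_ge0 ler_piMr ?a0// ler_pdivrMr// mul1r.
  exact: le_hypot.
have x00 : x = 0 by apply/eqP; rewrite eq_le x_le0.
have hE y : 0 <= y -> h y = y.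
  by move=> y0; rewrite /h x00 expr0n/= add0r sqrtr_sqr ger0_norm.
rewrite !hE ?(ltW r0)//.
apply: (derive_ge0_le (fun y => T y - Phi y) (fun y => a (h y) - a y)) => //; last exact: ltW.
  move=> y /andP[y0 _]; apply: is_derive_sub; [apply: dT|apply: dPhi]; lra.
by move=> y /andP[y0 _]; rewrite hE// subrr.
Qed.

(** The pointwise bound e <= d / (2 pi) + C |grad v|^q is integrated in z over a
   period, then in y and x over [0, r]. By [line_integral_ge], the left-hand side
   becomes at least the integral of Phi(r) - Phi(x) over [0, r], for a primitive
   Phi of the slice energy; by parts, this is the integral of s a(s) over
   [0, r]. The term in C stays below the finite integral over the slab. *)
Lemma energy_growth (q : R) (v : 'rV[R]_3 -> 'rV[R]_3) (e : R -> R -> R) :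
  2 <= q -> (grad_Lq_integral q v < +oo)%E -> continuous (grad_norm v) ->
  (forall s, continuous (e s)) -> continuous (fun s => zint (e s)) ->
  (forall s z, 0 <= e s z) ->
  (forall x y z, e (Num.sqrt (x ^+ 2 + y ^+ 2)) z <= grad_norm v (pt x y z) ^+ 2) ->
  exists A : R -> R, (forall r, 0 < r -> is_derive r 1 A (r * zint (e r))) /\
    forall d, 0 < d -> exists C : R, forall r, 0 < r -> A r <= d * r ^+ 2 + C.
Proof.
move=> q2 hint cf ce ca e0 le_ef.
have pi0 : 0 < (pi : R) := pi_gt0 R.
pose a s := zint (e s).
have a0 s : 0 <= a s by apply: zint_ge0.
have csa : continuous (fun s => s * a s) by move=> s; apply: cvgM; [exact: cvg_id|exact: ca].
have [A dA] := antiderivative (fun s => s * a s) (-1) csa.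
have [Phi dPhi] := antiderivative a (-1) ca.
exists (fun r => A r - A 0); split => [r r0|d d0].
  by rewrite -[X in is_derive _ _ _ X]subr0; apply: is_derive_sub; apply: dA; lra.
have [C0 C00 hC0] := sqr_le_powR q (d / (2 * pi)) q2 (divr_gt0 d0 (mulr_gt0 (ltr0n _ 2) pi0)).
pose T3 := (measurableTypeR R * measurableTypeR R * measurableTypeR R)%type.
pose F : T3 -> \bar R := (fun y : T3 => (grad_norm v (pt y.1.1 y.1.2 y.2) `^ q)%:E) \_ slab.
have mslab : measurable (slab : set T3).
  rewrite (_ : slab = (setT : set (measurableTypeR R * measurableTypeR R)) `*` `[- pi, pi]%classic).
    by apply: measurableX.
  by apply/seteqP; split => [[xy z] /= h|[xy z] /= [_]]; rewrite in_itv.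
have mF : measurable_fun setT F.
  apply/(measurable_restrictT _ mslab)/measurable_EFinP.
  apply: measurable_funTS; apply: (measurableT_comp (measurable_powR q)).
  exact: pt_measurable.
have F0 t : (0 <= F t)%E.
  by apply: erestrict_ge0 => t0 _; rewrite lee_fin powR_ge0.
pose k1 := fubini_F mu F.
pose k2 := fubini_F mu k1.
have mk1 : measurable_fun setT k1 by apply: measurable_fun_fubini_tonelli_F.
have k10 t : (0 <= k1 t)%E by apply: integral_ge0.
have mk2 : measurable_fun setT k2 by apply: measurable_fun_fubini_tonelli_F.
have k20 x : (0 <= k2 x)%E by apply: integral_ge0.
have E : grad_Lq_integral q v = (\int[mu]_x k2 x)%E.
  rewrite /grad_Lq_integral integral_mkcond -/F fubini_tonelli1//.
  by rewrite /lebesgue2 fubini_tonelli1.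
have [m mE] : exists m : R, grad_Lq_integral q v = m%:E.
  exists (fine (grad_Lq_integral q v)); rewrite fineK// ge0_fin_numE//.
  by rewrite E; apply: integral_ge0.
exists (C0 * m) => r r0.
have d1 : 0 <= d / (2 * pi) by rewrite divr_ge0 ?mulr_ge0 ?ltW.
have stage_z x y : ((a (Num.sqrt (x ^+ 2 + y ^+ 2)))%:E <= d%:E + C0%:E * k1 (x, y))%E.
  have -> : d = d / (2 * pi) * (pi - - pi).
    by rewrite opprK -mulr2n -[pi *+ 2]mulr_natl divfK// gt_eqF ?mulr_gt0.
  set s := Num.sqrt _.
  have cs : {within `[- pi, pi], continuous (e s)} by exact: continuous_subspaceT.
  have mFs : measurable_fun setT (fun z => F (x, y, z)).
    exact: (measurableT_comp mF (measurable_pair1 _)).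
  apply: (integral_segment_le (- pi) pi (d / (2 * pi)) C0 (e s) (fun z => F (x, y, z)) pi_itv cs
    (fun z _ => e0 s z) d1 C00 mFs (fun z => F0 (x, y, z))).
  move=> z zpi; rewrite /F /patch mem_set//= -EFinM -EFinD lee_fin.
  by apply: le_trans (le_ef x y z) _; apply: hC0; exact: sqrtr_ge0.
have ch x : continuous (fun y => a (Num.sqrt (x ^+ 2 + y ^+ 2))).
  by move=> y; apply: (@continuous_comp _ _ _ (fun y => Num.sqrt (x ^+ 2 + y ^+ 2)) a);
    [exact: continuous_hypot|exact: ca].
have stage_y x : ((\int[mu]_(y in `[0, r]) a (Num.sqrt (x ^+ 2 + y ^+ 2)))%:E <=
    (d * r)%:E + C0%:E * k2 x)%E.
  rewrite -[X in (d * X)%:E]subr0.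
  have cs := continuous_subspaceT (A := `[0, r]%classic) (ch x).
  have mk : measurable_fun setT (fun y => k1 (x, y)).
    exact: (measurableT_comp mk1 (measurable_pair1 _)).
  exact: (integral_segment_le 0 r d C0 _ (fun y => k1 (x, y)) r0 cs
    (fun y _ => a0 _) (ltW d0) C00 mk (fun y => k10 (x, y)) (fun y _ => stage_z x y)).
have dPhi0 s : 0 <= s -> is_derive s 1 Phi (a s) by move=> s0; apply: dPhi; lra.
have cPhi : {within `[0, r], continuous (fun x => Phi r - Phi x)}.
  apply: derivable_within_continuous => x; rewrite in_itv/= => /andP[x0 _].
  by have [] := is_derive_sub _ _ _ _ x (is_derive_const (Phi r) x) (dPhi0 x x0).
have Phi_ge0 x : 0 <= x <= r -> 0 <= Phi r - Phi x.
  move=> /andP[x0 xr]; rewrite subr_ge0.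
  by apply: (derive_ge0_le Phi a) => // s /andP[xs _]; apply: dPhi0; exact: le_trans xs.
have stage_x : ((\int[mu]_(x in `[0, r]) (Phi r - Phi x))%:E <=
    (d * r * (r - 0))%:E + C0%:E * \int[mu]_x k2 x)%E.
  apply: (integral_segment_le 0 r (d * r) C0 _ k2 r0 cPhi Phi_ge0
    (mulr_ge0 (ltW d0) (ltW r0)) C00 mk2 k20).
  move=> x xr; apply: le_trans (stage_y x); rewrite lee_fin.
  by apply: line_integral_ge => // s s1; exact: dPhi.
have EA : \int[mu]_(x in `[0, r]) (Phi r - Phi x) = A r - A 0.
  pose B x := x * (Phi r - Phi x) + A x.
  have dB x : 0 <= x -> is_derive x 1 B (Phi r - Phi x).
    move=> x0.
    have dx := is_derive_add _ _ _ _ _ (is_derive_mul id _ _ _ x (is_derive_id x 1)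
      (is_derive_sub _ _ _ _ x (is_derive_const (Phi r) x) (dPhi0 x x0)))
      (dA x (lt_le_trans (ltrN10 R) x0)).
    by apply: is_derive_eq dx _; rewrite /=; ring.
  have dB_itv x : 0 <= x <= r -> is_derive x 1 B (Phi r - Phi x).
    by move=> /andP[x0 _]; exact: dB.
  rewrite (FTC_segment _ B 0 r r0 cPhi dB_itv).
  by rewrite /B subrr mulr0 add0r mul0r add0r.
move: stage_x; rewrite EA -E mE -EFinM -EFinD lee_fin subr0.
by rewrite -mulrA -expr2.
Qed.

End EnergyGrowth.

(** * Axisymmetric flows without swirl *)

Section Axisymmetric.
Local Opaque partial.
Local Open Scope classical_set_scope.
Local Open Scope ring_scope.
Context {R : realType}.
Implicit Types (f g : 'rV[R]_3 -> R) (a b c r s t x y z : R).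

Lemma radius_cyl r t z : 0 < r -> Defs.radius (cyl r t z) = r.
Proof.
move=> r0; rewrite /Defs.radius /cyl !ptE !exprMn -mulrDr cos2Dsin2 mulr1.
by rewrite sqrtr_sqr gtr0_norm.
Qed.

Context (v : 'rV[R]_3 -> 'rV[R]_3) (p : 'rV[R]_3 -> R).
Hypotheses (hv : smooth_field v) (hp : smooth p) (hper : periodic_x3 v)
  (hNS : stationary_NS v p) (haxi : axisymmetric v p) (hswirl : no_swirl v).

Let U := vcomp v 0.
Let V := vcomp v 1.
Let W := vcomp v 2.
Let u := meridian U.
Let w := meridian W.
Let sU : smooth U. Proof. exact: hv. Qed.
Let sV : smooth V. Proof. exact: hv. Qed.
Let sW : smooth W. Proof. exact: hv. Qed.

Lemma velocity_cyl r t z : 0 < r ->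
  [/\ U (cyl r t z) = u r z * cos t, V (cyl r t z) = u r z * sin t &
      W (cyl r t z) = w r z].
Proof.
move=> r0; have [hr _ hz _] := haxi.
have c0 : cyl r 0 z = pt r 0 z by rewrite /cyl cos0 sin0 mulr1 mulr0.
have := hr r t 0 z r0; have := hz r t 0 z r0; have := hswirl (cyl r t z).
rewrite radius_cyl// => /(_ r0).
rewrite /v_r /v_z /v_theta /dot !sum3 /e_r /e_theta /e_z !radius_cyl// !ptE.
have rK a : r * a / r = a by field; rewrite gt_eqF.
rewrite !mulNr !rK c0 cos0 sin0 !(mulr0, mulr1, addr0, add0r) => e1 e2 e3.
have cs := cos2Dsin2 t.
rewrite -[v (cyl r t z) 0 0]/(U (cyl r t z)) -[v (cyl r t z) 0 1]/(V (cyl r t z))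
  -[v _ 0 0]/(u r z) in e1 e2 e3.
split=> //.
- rewrite -e3 -[LHS]mulr1 -cs.
  have : sin t * (U (cyl r t z) * - sin t + V (cyl r t z) * cos t) = 0.
    by rewrite e1 mulr0.
  lra.
- rewrite -e3 -[LHS]mulr1 -cs.
  have : cos t * (U (cyl r t z) * - sin t + V (cyl r t z) * cos t) = 0.
    by rewrite e1 mulr0.
  lra.
Qed.

(** The horizontal velocity is expressed by x and y times a function of the
   distance to the axis; no angle is left to differentiate. *)
Lemma velocity_pt x y z : let s := Num.sqrt (x ^+ 2 + y ^+ 2) in 0 < s ->
  [/\ U (pt x y z) = x * (u s z / s), V (pt x y z) = y * (u s z / s) &
      W (pt x y z) = w s z].
Proof.
move=> s s0.
have [|t [ct st]] := polar_angle (x / s) (y / s).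
  rewrite !expr_div_n -mulrDl sqr_sqrtr ?addr_ge0 ?sqr_ge0// divff//.
  by move: s0; rewrite sqrtr_gt0 => /gt_eqF ->.
have E : pt x y z = cyl s t z.
  by rewrite /cyl ct st; congr pt; field; rewrite gt_eqF.
by rewrite E; have [-> -> ->] := velocity_cyl s t z s0; rewrite ct st;
  split => //; field; rewrite gt_eqF.
Qed.

Let u1 := meridian (partial 0 U).
Let u2 := meridian (partial 2 U).
Let w1 := meridian (partial 0 W).
Let w2 := meridian (partial 2 W).
Let hypot x y := Num.sqrt (x ^+ 2 + y ^+ 2).

Let hypot_gt0 r y : 0 < r -> 0 < hypot r y.
Proof. by move=> r0; rewrite sqrtr_gt0 ltr_pwDl ?exprn_gt0// sqr_ge0. Qed.

Let hypot0 r : 0 < r -> hypot r 0 = r.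
Proof. by move=> r0; rewrite /hypot expr0n/= addr0 sqrtr_sqr gtr0_norm. Qed.

Let hypotC x y : hypot x y = hypot y x.
Proof. by rewrite /hypot addrC. Qed.

Let near_hypot_gt0 x y : 0 < hypot x y -> \forall t \near x, 0 < hypot t y.
Proof.
rewrite sqrtr_gt0 => p0.
have c : {for x, continuous (fun t : R => t * t + y ^+ 2)}.
  apply: is_derive_continuous (is_derive_add _ _ _ _ _
    (is_derive_mul id id _ _ x _ _) (is_derive_const _ _)); exact: is_derive_id.
move: c => /cvgr_gt /(_ 0); rewrite -expr2 => /(_ p0).
by apply: filterS => t; rewrite /hypot sqrtr_gt0 -expr2.
Qed.

Lemma partial2_horizontal x y z : 0 < hypot x y ->
  partial 2 U (pt x y z) = x * (u2 (hypot x y) z / hypot x y) /\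
  partial 2 V (pt x y z) = y * (u2 (hypot x y) z / hypot x y).
Proof.
move=> s0.
have d : is_derive z 1 (fun z => u (hypot x y) z / hypot x y)
    (u2 (hypot x y) z / hypot x y).
  by have [_ _ _ _ d] := C1_div_r _ _ _ (C1_meridian U sU); exact: d.
split.
- apply: (eq_is_derive _ _ z _ _ _ (is_derive_pt2 U x y z sU) (is_derive_scale x _ _ _ d)).
  by apply/funext => t; have [] := velocity_pt x y t s0.
- apply: (eq_is_derive _ _ z _ _ _ (is_derive_pt2 V x y z sV) (is_derive_scale y _ _ _ d)).
  by apply/funext => t; have [] := velocity_pt x y t s0.
Qed.

Lemma partial_vertical x y z : 0 < hypot x y ->
  partial 0 W (pt x y z) = x * (w1 (hypot x y) z / hypot x y) /\
  partial 1 W (pt x y z) = y * (w1 (hypot x y) z / hypot x y).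
Proof.
move=> s0.
have d a b : 0 < hypot a b ->
    is_derive b 1 (fun b => w (hypot a b) z) (b * (w1 (hypot a b) z / hypot a b)).
  move=> p0.
  have [_ _ _ dw _] := C1_meridian W sW.
  apply: is_derive_eq (is_derive_chain (w ^~ z) (hypot a) _ _ b (dw _ _ p0)
    (is_derive_hypot a b _)) _ => //; first by rewrite -sqrtr_gt0.
  by rewrite mulrC -mulrA [X in _ * X]mulrC.
split.
- have s0' : 0 < hypot y x by rewrite hypotC.
  rewrite hypotC; apply: (near_eq_derive_eq _ _ x _ _ _ (is_derive_pt0 W x y z sW) (d y x s0')).
  apply: filterS (near_hypot_gt0 x y s0) => t t0.
  by have [_ _ ->] := velocity_pt t y z t0; rewrite -/(hypot t y) hypotC.
- apply: (near_eq_derive_eq _ _ y _ _ _ (is_derive_pt1 W x y z sW) (d x y s0)).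
  have s0' : 0 < hypot y x by rewrite hypotC.
  apply: filterS (near_hypot_gt0 y x s0') => t; rewrite hypotC => t0.
  by have [_ _ ->] := velocity_pt x t z t0.
Qed.

(** The vector (x, y) / hypot x y being a unit vector, the vertical derivative of
   the horizontal velocity has norm |u2|, and the horizontal gradient of the
   vertical velocity has norm |w1|. *)
Lemma grad_norm_ge x y z : 0 < hypot x y ->
  u2 (hypot x y) z ^+ 2 + w1 (hypot x y) z ^+ 2 <= grad_norm v (pt x y z) ^+ 2.
Proof.
move=> s0; rewrite /grad_norm sqr_sqrtr; last first.
  by do 2 (apply: sumr_ge0 => ? _); exact: sqr_ge0.
have [e1 e2] := partial2_horizontal x y z s0.
have [e3 e4] := partial_vertical x y z s0.
rewrite !sum3 -/U -/V -/W e1 e2 e3 e4.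
have E b : (x * (b / hypot x y)) ^+ 2 + (y * (b / hypot x y)) ^+ 2 = b ^+ 2.
  have h : x ^+ 2 + y ^+ 2 = hypot x y ^+ 2.
    by rewrite sqr_sqrtr// addr_ge0 ?sqr_ge0.
  by rewrite !exprMn -mulrDl h exprVn mulrCA mulfV ?mulr1// expf_neq0// gt_eqF.
rewrite -(E (u2 _ z)) -(E (w1 _ z)).
have add_ge0 : forall a1 a2 a3 a4 a5 b1 b2 b3 b4 : R, 0 <= a1 -> 0 <= a2 ->
    0 <= a3 -> 0 <= a4 -> 0 <= a5 ->
    b1 + b2 + (b3 + b4) <= a1 + a2 + b1 + (a3 + a4 + b2) + (b3 + b4 + a5).
  by move=> *; lra.
by apply: add_ge0; exact: sqr_ge0.
Qed.

(** The distance to the axis is stationary in the direction across the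
   half-plane, so only the factor y contributes. The derivatives across the
   half-plane which occur in the equations are all of this form. *)
Let is_derive_cross (L : R -> R) r l : 0 < r -> is_derive r 1 L l ->
  is_derive (0 : R) 1 (fun y => y * L (hypot r y)) (L r).
Proof.
move=> r0 dL.
have dh : is_derive (0 : R) 1 (hypot r) (0 / hypot r 0).
  by apply: is_derive_hypot; rewrite expr0n/= addr0 exprn_gt0.
have dL' : is_derive (hypot r 0) 1 L l by rewrite hypot0.
apply: is_derive_eq (is_derive_mul id (fun y => L (hypot r y)) _ _ 0 (is_derive_id _ _)
  (is_derive_chain L (hypot r) _ _ 0 dL' dh)) _.
by rewrite hypot0// mul1r mul0r addr0.
Qed.

Lemma partial1_V r z : 0 < r -> partial 1 V (pt r 0 z) = u r z / r.
Proof.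
move=> r0.
have [_ _ _ d _] := C1_div_r _ _ _ (C1_meridian U sU).
apply: (eq_is_derive _ _ 0 _ _ _ (is_derive_pt1 V r 0 z sV)
  (is_derive_cross _ _ _ r0 (d r z r0))).
by apply/funext => y; have [] := velocity_pt r y z (hypot_gt0 r y r0).
Qed.

Lemma partial11_W r z : 0 < r -> partial 1 (partial 1 W) (pt r 0 z) = w1 r z / r.
Proof.
move=> r0.
have [_ _ _ d _] := C1_div_r _ _ _ (C1_meridian _ (smooth_partial _ 0 sW)).
apply: (eq_is_derive _ _ 0 _ _ _ (is_derive_pt1 _ r 0 z (smooth_partial _ 1 sW))
  (is_derive_cross _ _ _ r0 (d r z r0))).
by apply/funext => y; have [] := partial_vertical r y z (hypot_gt0 r y r0).
Qed.

Lemma partial11_U r z : 0 < r ->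
  partial 1 (partial 1 U) (pt r 0 z) = u1 r z / r - u r z / r ^+ 2.
Proof.
move=> r0.
pose K' s z := u1 s z / s - u s z / s ^+ 2.
have CK := C1_div_r _ _ _ (C1_meridian U sU).
have E s y : partial 1 U (pt s y z) = y * (s * (K' (hypot s y) z / hypot s y)) \/ s <= 0.
  have [s0|] := ltP 0 s; [left|by right].
  have p0 := hypot_gt0 s y s0.
  have [_ _ _ d _] := CK.
  have dh : is_derive y 1 (hypot s) (y / hypot s y).
    by apply: is_derive_hypot; rewrite -sqrtr_gt0.
  have -> : y * (s * (K' (hypot s y) z / hypot s y)) = s * (K' (hypot s y) z * (y / hypot s y)).
    by rewrite mulrCA; congr (_ * _); rewrite mulrCA.
  apply: (eq_is_derive _ _ y _ _ _ (is_derive_pt1 U s y z sU)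
    (is_derive_scale s _ _ _ (is_derive_chain (fun s => u s z / s) (hypot s) _ _ y (d _ z p0) dh))).
  by apply/funext => t; have [] := velocity_pt s t z (hypot_gt0 s t s0).
have CK' := C1_add _ _ _ _ _ _ (C1_div_r _ _ _ (C1_meridian _ (smooth_partial _ 0 sU)))
  (C1_opp _ _ _ (C1_div_r _ _ _ CK)).
have [_ _ _ d _] := C1_div_r _ _ _ CK'.
have dr := is_derive_scale r _ _ _ (d r z r0).
rewrite (eq_is_derive _ _ 0 _ _ _ (is_derive_pt1 _ r 0 z (smooth_partial _ 1 sU))
  (is_derive_cross _ _ _ r0 dr)).
  by rewrite -/u -/u1; field; rewrite gt_eqF.
apply/funext => y; have [->|] := E r y; last by rewrite leNgt r0.
have div2 a b : a / b ^+ 2 = a / b / b by rewrite expr2 invfM mulrA.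
by rewrite /K' div2.
Qed.

Let u11 := meridian (partial 0 (partial 0 U)).
Let u22 := meridian (partial 2 (partial 2 U)).
Let w11 := meridian (partial 0 (partial 0 W)).
Let w22 := meridian (partial 2 (partial 2 W)).
Let p1 := meridian (partial 0 p).
Let p2 := meridian (partial 2 p).

Let V_plane r z : 0 < r -> v (pt r 0 z) 0 1 = 0.
Proof.
move=> r0; have [_ e _] := velocity_pt r 0 z (hypot_gt0 r 0 r0).
by rewrite -[LHS]/(V (pt r 0 z)) e mul0r.
Qed.

Lemma plane_div r z : 0 < r -> u r z + r * u1 r z + r * w2 r z = 0.
Proof.
move=> r0; have [_ /(_ (pt r 0 z))] := hNS.
rewrite /divergence sum3 -/U -/V -/W partial1_V// => e.
rewrite -[RHS](mulr0 r) -e /u1 /w2 /meridian.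
by field; rewrite gt_eqF.
Qed.

Lemma plane_momentum_r r z : 0 < r ->
  u r z * u1 r z + w r z * u2 r z + p1 r z =
  u11 r z + (u1 r z / r - u r z / r ^+ 2) + u22 r z.
Proof.
move=> r0; have [/(_ (pt r 0 z)) e _] := hNS.
have := congr1 (fun m : 'rV[R]_3 => m 0 0) e; rewrite !mxE /laplacian !sum3 -/U V_plane//.
by rewrite mul0r addr0 partial11_U.
Qed.

Lemma plane_momentum_z r z : 0 < r ->
  u r z * w1 r z + w r z * w2 r z + p2 r z = w11 r z + w1 r z / r + w22 r z.
Proof.
move=> r0; have [/(_ (pt r 0 z)) e _] := hNS.
have := congr1 (fun m : 'rV[R]_3 => m 0 2) e; rewrite !mxE /laplacian !sum3 -/W V_plane//.
by rewrite mul0r addr0 partial11_W.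
Qed.

Let om r z := u2 r z - w1 r z.
Let om1 r z := meridian (partial 0 (partial 2 U)) r z - w11 r z.
Let om2 r z := u22 r z - meridian (partial 2 (partial 0 W)) r z.
Let om11 r z := meridian (partial 0 (partial 0 (partial 2 U))) r z -
  meridian (partial 0 (partial 0 (partial 0 W))) r z.
Let om12 r z := meridian (partial 2 (partial 0 (partial 2 U))) r z -
  meridian (partial 2 (partial 0 (partial 0 W))) r z.
Let om21 r z := meridian (partial 0 (partial 2 (partial 2 U))) r z -
  meridian (partial 0 (partial 2 (partial 0 W))) r z.
Let om22 r z := meridian (partial 2 (partial 2 (partial 2 U))) r z -
  meridian (partial 2 (partial 2 (partial 0 W))) r z.

Let C1_meridian_sub f g : smooth f -> smooth g ->
  C1 (fun r z => meridian f r z - meridian g r z)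
     (fun r z => meridian (partial 0 f) r z - meridian (partial 0 g) r z)
     (fun r z => meridian (partial 2 f) r z - meridian (partial 2 g) r z).
Proof. by move=> sf sg; apply: C1_add (C1_meridian f sf) (C1_opp _ _ _ (C1_meridian g sg)). Qed.

Let Com : C1 om om1 om2.
Proof. by apply: C1_meridian_sub; apply: smooth_partial. Qed.
Let Com1 : C1 om1 om11 om12.
Proof. by apply: C1_meridian_sub; do 2 apply: smooth_partial. Qed.
Let Com2 : C1 om2 om21 om22.
Proof. by apply: C1_meridian_sub; do 2 apply: smooth_partial. Qed.

(** Differentiate the radial momentum equation in z and the axial one in r, and
   subtract: the pressure disappears since mixed derivatives agree, and the
   divergence equation eliminates w2. *)
Lemma plane_vorticity r z : 0 < r ->
  u r z * om1 r z + w r z * om2 r z - u r z / r * om r z =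
  om11 r z + om22 r z + om1 r z / r - om r z / r ^+ 2.
Proof.
move=> r0.
have Cp := @C1_meridian R.
have s0 f : smooth f -> smooth (partial 0 f) by exact: smooth_partial.
have s2 f : smooth f -> smooth (partial 2 f) by exact: smooth_partial.
have CU := Cp U sU; have CW := Cp W sW.
have CU0 := Cp _ (s0 _ sU); have CU2 := Cp _ (s2 _ sU).
have CW0 := Cp _ (s0 _ sW); have CW2 := Cp _ (s2 _ sW).
have CL1 := C1_add _ _ _ _ _ _ (C1_add _ _ _ _ _ _ (C1_mul _ _ _ _ _ _ CU CU0)
  (C1_mul _ _ _ _ _ _ CW CU2)) (Cp _ (s0 _ hp)).
have CR1 := C1_add _ _ _ _ _ _ (C1_add _ _ _ _ _ _ (Cp _ (s0 _ (s0 _ sU)))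
  (C1_add _ _ _ _ _ _ (C1_div_r _ _ _ CU0)
    (C1_opp _ _ _ (C1_div_r _ _ _ (C1_div_r _ _ _ CU))))) (Cp _ (s2 _ (s2 _ sU))).
have CL2 := C1_add _ _ _ _ _ _ (C1_add _ _ _ _ _ _ (C1_mul _ _ _ _ _ _ CU CW0)
  (C1_mul _ _ _ _ _ _ CW CW2)) (Cp _ (s2 _ hp)).
have CR2 := C1_add _ _ _ _ _ _ (C1_add _ _ _ _ _ _ (Cp _ (s0 _ (s0 _ sW)))
  (C1_div_r _ _ _ CW0)) (Cp _ (s2 _ (s2 _ sW))).
have [_ _ _ _ dL1] := CL1; have [_ _ _ _ dR1] := CR1.
have F1 : (fun t => u r t * u1 r t + w r t * u2 r t + p1 r t) =
    (fun t => u11 r t + (u1 r t / r + - (u r t / r / r)) + u22 r t).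
  apply/funext => t; rewrite plane_momentum_r//.
  by rewrite (_ : u r t / r ^+ 2 = u r t / r / r)// expr2 invfM mulrA.
have e1 := eq_is_derive _ _ z _ _ F1 (dL1 r z r0) (dR1 r z r0).
have [_ _ _ dL2 _] := CL2; have [_ _ _ dR2 _] := CR2.
have e2 := is_derive_unique _ _ _ _ r r0 (plane_momentum_z ^~ z)
  (dL2 r z r0) (dR2 r z r0).
have rn : r != 0 by rewrite gt_eqF.
have e3 : w2 r z = - (u r z + r * u1 r z) / r.
  exact: solve_div rn (plane_div r z r0).
have k1 := congr1 (fun f => meridian f r z) (partial_comm3 U 0 2 sU).
have k2 := congr1 (fun f => meridian f r z) (partial_comm3 W 2 0 sW).
have k3 := congr1 (fun f => meridian f r z) (partial_comm U 2 0 sU).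
have k4 := congr1 (fun f => meridian f r z) (partial_comm W 2 0 sW).
have k5 := congr1 (fun f => meridian f r z) (partial_comm p 2 0 hp).
move: e1 e2 e3 k1 k2 k3 k4 k5.
rewrite /om /om1 /om2 /om11 /om22 /u /w /u1 /u2 /w1 /w2 /w11 /u22 /=.
(* What remains is algebra in the values of the derivatives. *)
generalize (meridian U r z) (meridian W r z)
  (meridian (partial 0 U) r z) (meridian (partial 2 U) r z)
  (meridian (partial 0 W) r z) (meridian (partial 2 W) r z)
  (meridian (partial 0 (partial 0 U)) r z) (meridian (partial 0 (partial 2 U)) r z)
  (meridian (partial 2 (partial 0 U)) r z) (meridian (partial 2 (partial 2 U)) r z)
  (meridian (partial 0 (partial 0 W)) r z) (meridian (partial 0 (partial 2 W)) r z)
  (meridian (partial 2 (partial 0 W)) r z) (meridian (partial 2 (partial 2 W)) r z)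
  (meridian (partial 2 (partial 0 p)) r z) (meridian (partial 0 (partial 2 p)) r z)
  (meridian (partial 0 (partial 0 (partial 2 U))) r z)
  (meridian (partial 2 (partial 0 (partial 0 U))) r z)
  (meridian (partial 2 (partial 2 (partial 2 U))) r z)
  (meridian (partial 0 (partial 0 (partial 0 W))) r z)
  (meridian (partial 0 (partial 2 (partial 2 W))) r z)
  (meridian (partial 2 (partial 2 (partial 0 W))) r z).
move=> a b a0 a2 b0 b2 a00 a02 a20 a22 b00 b02 b20 b22 q1 q2 a002 a200 a222 b000 b022 b220.
move=> e1 e2 e3 k1 k2 k3 k4 k5.
move: e1 e2; rewrite k1 k3 k5 k2 k4 e3 => e1 e2.
have := congr2 (fun s t => s - t) e1 e2 => {}e1.
apply/eqP; rewrite -subr_eq0; move/eqP: e1; rewrite -subr_eq0 => /eqP e1.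
apply/eqP; rewrite -[RHS]e1; field.
exact: rn.
Qed.

Let u_axis z : u 0 z = 0.
Proof.
apply: (vanishes_at_limit (fun y => U (pt 0 y z))) => [|y y0].
  exact: is_derive_continuous (is_derive_pt1 U 0 0 z sU).
have s0 : 0 < hypot 0 y by rewrite /hypot addrC hypot_gt0.
by have [e _ _] := velocity_pt 0 y z s0; apply: (etrans e); rewrite mul0r.
Qed.

Let V_axis z : V (pt 0 0 z) = 0.
Proof.
apply: (vanishes_at_limit (fun x => V (pt x 0 z))) => [|x x0].
  exact: is_derive_continuous (is_derive_pt0 V 0 0 z sV).
by have [_ e _] := velocity_pt x 0 z (hypot_gt0 x 0 x0); apply: (etrans e); rewrite mul0r.
Qed.

Let u2_axis z : u2 0 z = 0.
Proof.
have [_ e] := is_derive_pt2 U 0 0 z sU; apply: (etrans (esym e)).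
have -> : (fun t => U (pt 0 0 t)) = (fun=> 0) by apply/funext => t; exact: u_axis.
exact: derive_cst.
Qed.

Let w_even s z : w (- s) z = w s z.
Proof.
have pos r : 0 < r -> w (- r) z = w r z.
  move=> r0; have s0 : 0 < hypot (- r) 0 by rewrite /hypot sqrrN hypot_gt0.
  have [_ _ e] := velocity_pt (- r) 0 z s0.
  by apply: (etrans e); rewrite sqrrN -/(hypot r 0) hypot0.
have [s0|s0|->] := ltgtP s 0; last by rewrite oppr0.
  by rewrite -(pos (- s)) ?oppr_gt0// opprK.
exact: pos.
Qed.

(** The derivative of an even function vanishes at 0. *)
Let w1_axis z : w1 0 z = 0.
Proof.
have d0 : is_derive (0 : R) 1 (w ^~ z) (w1 0 z) := is_derive_pt0 W 0 0 z sW.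
have d0' : is_derive (- 0 : R) 1 (w ^~ z) (w1 0 z) by rewrite oppr0.
have d1 := is_derive_chain (w ^~ z) (fun s => - s) _ _ (0 : R) d0'
  (is_derive_opp _ _ _ (is_derive_id (0 : R) 1)).
have e : (fun s => w (- s) z) = w ^~ z by apply/funext => s; exact: w_even.
have := eq_is_derive _ _ 0 _ _ e d1 d0; lra.
Qed.

Let om_axis z : om 0 z = 0.
Proof. by rewrite /om u2_axis w1_axis subr0. Qed.

(** By the mean value theorem, om / r is a value of om1, and om1 - om / r is then
   r times at most a value of om11; all derivatives of a smooth field are bounded
   near a segment of the axis. *)
Let axis_bounds : exists K, forall r z, 0 < r <= 1 -> - pi <= z <= pi ->
  [/\ `|u r z| <= K, `|u1 r z| <= K, `|om r z| <= K * r &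
      `|om1 r z - om r z / r| <= K * r].
Proof.
have bounded f : smooth f -> exists2 K, 0 <= K & forall r z, 0 <= r <= 1 ->
    - pi <= z <= pi -> `|meridian f r z| <= K.
  move=> sf; apply: bounded_on_rectangle => r z _ _.
  by apply: cont_meridian; exact: smooth_continuous.
have s0 f : smooth f -> smooth (partial 0 f) by exact: smooth_partial.
have s2 f : smooth f -> smooth (partial 2 f) by exact: smooth_partial.
have [Ka Ka0 hKa] := bounded _ sU.
have [Kb Kb0 hKb] := bounded _ (s0 _ sU).
have [Kc Kc0 hKc] := bounded _ (s0 _ (s2 _ sU)).
have [Kd Kd0 hKd] := bounded _ (s0 _ (s0 _ sW)).
have [Ke Ke0 hKe] := bounded _ (s0 _ (s0 _ (s2 _ sU))).
have [Kf Kf0 hKf] := bounded _ (s0 _ (s0 _ (s0 _ sW))).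
pose K := Ka + Kb + (Kc + Kd) + (Ke + Kf).
have [K0 KaK KbK KcK KeK] := sum_ge_parts _ _ _ _ _ _ Ka0 Kb0 Kc0 Kd0 Ke0 Kf0.
rewrite -/K in K0 KaK KbK KcK KeK.
have om1K r z : 0 <= r <= 1 -> - pi <= z <= pi -> `|om1 r z| <= Kc + Kd.
  move=> r01 zpi; apply: le_trans (ler_normB _ _) _; apply: lerD; [exact: hKc|exact: hKd].
have om11K r z : 0 <= r <= 1 -> - pi <= z <= pi -> `|om11 r z| <= Ke + Kf.
  move=> r01 zpi; apply: le_trans (ler_normB _ _) _; apply: lerD; [exact: hKe|exact: hKf].
have dom z s : is_derive s 1 (om ^~ z) (om1 s z).
  by apply: is_derive_sub; [exact: (is_derive_pt0 _ s 0 z (s2 _ sU))|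
    exact: (is_derive_pt0 _ s 0 z (s0 _ sW))].
have dom1 z s : is_derive s 1 (om1 ^~ z) (om11 s z).
  by apply: is_derive_sub; [exact: (is_derive_pt0 _ s 0 z (s0 _ (s2 _ sU)))|
    exact: (is_derive_pt0 _ s 0 z (s0 _ (s0 _ sW)))].
exists K => r z /andP[r0 r1] zpi.
have r01 : 0 <= r <= 1 by rewrite ltW.
have [c /andP[c0 c1] Ec] := MVT_derive (om ^~ z) (om1 ^~ z) 0 r r0 (dom z).
rewrite om_axis !subr0 in Ec.
split.
- exact: le_trans (hKa r z r01 zpi) KaK.
- exact: le_trans (hKb r z r01 zpi) KbK.
- rewrite Ec normrM (gtr0_norm r0) ler_pM2r//.
  have c01 : 0 <= c <= 1 by rewrite c0 (le_trans c1).
  exact: le_trans (om1K c z c01 zpi) KcK.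
- rewrite Ec mulfK ?gt_eqF//.
  have [->|cr] := eqVneq c r.
    by rewrite subrr normr0 mulr_ge0 ?(ltW r0).
  have cr' : c < r by rewrite lt_neqAle cr.
  have [d /andP[d0 d1] Ed] := MVT_derive (om1 ^~ z) (om11 ^~ z) c r cr' (dom1 z).
  have d01 : 0 <= d <= 1 by rewrite (le_trans c0 d0) (le_trans d1 r1).
  rewrite Ed normrM; apply: ler_pM => //.
    exact: le_trans (om11K d z d01 zpi) KeK.
  by rewrite ger0_norm ?subr_ge0 ?(ltW cr')// gerBl.
Qed.

Let per f := forall r z, 0 < r -> meridian f r (z + 2 * pi) = meridian f r z.

Let T : 'rV[R]_3 := pt 0 0 (2 * pi).

Let shift_per f : (forall x : 'rV[R]_3, f (x + T) = f x) -> per f.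
Proof.
move=> pf r z _; rewrite /meridian -(pf (pt r 0 z)); congr f; apply/esym.
by apply: rV3P; rewrite mxE /T !ptE ?addr0.
Qed.

Let TU (x : 'rV[R]_3) : U (x + T) = U x.
Proof. by apply: shift_periodic => a b c; rewrite /U /vcomp hper. Qed.

Let TW (x : 'rV[R]_3) : W (x + T) = W x.
Proof. by apply: shift_periodic => a b c; rewrite /W /vcomp hper. Qed.

Theorem no_swirl_liouville (q : R) : 2 <= q -> (grad_Lq_integral q v < +oo)%E ->
  exists c : 'rV[R]_3, forall x : 'rV[R]_3, v x = c.
Proof.
move=> q2 hint.
have s0 f : smooth f -> smooth (partial 0 f) by exact: smooth_partial.
have s2 f : smooth f -> smooth (partial 2 f) by exact: smooth_partial.
pose e s z := u2 s z ^+ 2 + w1 s z ^+ 2.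
have e0 s z : 0 <= e s z by rewrite addr_ge0 ?sqr_ge0.
have cpl f s : smooth f -> continuous (meridian f s).
  by move=> sf z; exact: is_derive_continuous (is_derive_pt2 f s 0 z sf).
have ce s : continuous (e s).
  move=> z; apply: cvgD; apply: cvgM; apply: cpl; exact: smooth_partial.
have cze : continuous (fun s => zint (e s)) := continuous_zint_sum_sq _ _ (s2 _ sU) (s0 _ sW).
have le_e x y z : e (hypot x y) z <= grad_norm v (pt x y z) ^+ 2.
  have [h0|] := ltP 0 (hypot x y); first exact: grad_norm_ge.
  rewrite le_eqVlt ltNge sqrtr_ge0 orbF => /eqP ->.
  by rewrite /e u2_axis w1_axis expr0n/= addr0 sqr_ge0.
have [A [dA hA]] := energy_growth q v e q2 hint (continuous_grad_norm v hv) ce cze e0 le_e.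
have [K hK] := axis_bounds.
have Cw2 : C1 w2 (meridian (partial 2 (partial 0 W))) (meridian (partial 2 (partial 2 W))).
  rewrite (partial_comm W 2 0 sW); exact: C1_meridian (s2 _ sW).
have pp := @partial_periodic R.
have main r z : 0 < r -> u r z = 0 /\ w r z = w 1 0.
  apply: (meridional_liouville _ _ _ _ _ _ _ _ _ _ _ _ _ _ _ _ _ _ A (C1_meridian U sU)
    (C1_meridian _ (s0 _ sU)) (C1_meridian W sW) (C1_meridian _ (s0 _ sW)) Cw2 Com Com1 Com2
    (fun _ _ _ => erefl) plane_div plane_vorticity (shift_per _ TU) (shift_per _ TW)
    (shift_per _ (pp _ _ _ TW)) _ _ K hK dA hA).
  - move=> s y s_gt0.
    have e1 : u2 s (y + 2 * pi) = u2 s y := shift_per _ (pp U 2 T TU) s y s_gt0.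
    have e2 : w1 s (y + 2 * pi) = w1 s y := shift_per _ (pp W 0 T TW) s y s_gt0.
    by rewrite /om e1 e2.
  - move=> s y s_gt0.
    have e1 := shift_per _ (pp _ 2 T (pp U 2 T TU)) s y s_gt0.
    have e2 := shift_per _ (pp _ 2 T (pp W 0 T TW)) s y s_gt0.
    exact: (etrans (congr1 (fun a => a - _) e1) (congr1 (fun b => _ - b) e2)).
have w_axis z : w 0 z = w 1 0.
  apply/eqP; rewrite -subr_eq0; apply/eqP.
  apply: (vanishes_at_limit (fun t => w t z - w 1 0)) => [|t t0].
    apply: is_derive_continuous (is_derive_sub _ _ _ _ 0 (is_derive_pt0 W 0 0 z sW)
      (is_derive_const _ _)).
  by have [_ ->] := main t z t0; rewrite subrr.
exists (pt 0 0 (w 1 0)) => x; rewrite -(pt_eta x).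
move: (x 0 0) (x 0 1) (x 0 2) => a b c.
have [h0|h0] := ltP 0 (hypot a b).
  have [eU eV eW] := velocity_pt a b c h0; have [u0 w0] := main (hypot a b) c h0.
  apply: rV3P; rewrite ptE.
  - by apply: (etrans eU); rewrite -/(hypot a b) u0 mul0r mulr0.
  - by apply: (etrans eV); rewrite -/(hypot a b) u0 mul0r mulr0.
  - exact: (etrans eW).
have : a ^+ 2 + b ^+ 2 = 0.
  have ab0 : 0 <= a ^+ 2 + b ^+ 2 by rewrite addr_ge0 ?sqr_ge0.
  apply/eqP; rewrite eq_le ab0 andbT leNgt; apply/negP => ab.
  by move: h0; rewrite leNgt sqrtr_gt0 ab.
move/eqP; rewrite paddr_eq0 ?sqr_ge0// !sqrf_eq0 => /andP[/eqP -> /eqP ->].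
apply: rV3P; rewrite ptE.
- exact: u_axis.
- exact: V_axis.
- exact: w_axis.
Qed.

End Axisymmetric.

Theorem theorem1p2 (R : realType) (q : R)
  (v : 'rV[R]_3 -> 'rV[R]_3) (p : 'rV[R]_3 -> R)
  (hq : (2 <= q)%R)
  (hv : smooth_field v) (hp : smooth p)
  (hper : periodic_x3 v)
  (hNS : stationary_NS v p)
  (haxi : axisymmetric v p)
  (hswirl : no_swirl v)
  (hint : (grad_Lq_integral q v < +oo)%E) :
  exists c : 'rV[R]_3, forall x : 'rV[R]_3, v x = c.
Proof.
exact: (no_swirl_liouville v p hv hp hper hNS haxi hswirl q hq hint).
Qed.
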